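(* Let $f(n)$ denote the number of unordered factorizations of a positive integer $n$ into integers larger than one, and $F(n)$ the number of unordered factorizations of $n$ into pairwise coprime integers larger than one. For every fixed $\beta > 0$, as $x\to\infty$, each of the sums \[\sum_{n \leq x} f(n)^{-\beta}, \qquad \sum_{n \leq x} F(n)^{-\beta}\] equals \[\frac{x}{\log x} \exp\Bigl((1 + o(1))\bigl((1 + \beta)(\log_2 x)(\log_3 x)^\beta\bigr)^{1/(1 + \beta)}\Bigr).\]
   Context: $\log_k$ denotes the $k$-th iterate of the natural logarithm. By convention $f(1)=F(1)=1$. *)

(* Defs.v *)
From mathcomp Require Import all_boot all_order all_algebra.
From mathcomp Require Export finmap multiset.
From mathcomp Require Export all_classical all_reals all_analysis.

Set Implicit Arguments.
Unset Strict Implicit.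
Unset Printing Implicit Defensive.

Import Order.TTheory GRing.Theory Num.Theory.
Import numFieldNormedType.Exports.

Local Open Scope classical_set_scope.
Local Open Scope nat_scope.

Definition factorizations (n : nat) : set {mset nat}%mset :=
  [set s : {mset nat}%mset | all (fun d => 1 < d) s /\ \prod_(d <- s) d = n].

(* [pairwise] compares entries at distinct positions, so a repeated factor
   [d > 1] is excluded. *)
Definition coprime_factorizations (n : nat) : set {mset nat}%mset :=
  [set s : {mset nat}%mset | factorizations n s /\ pairwise coprime s].

(* [fset_set A] is empty when [A] is infinite; finiteness for [n > 0] is
   [finite_factorizations] below. *)
Definition num_fact (n : nat) : nat := #|` fset_set (factorizations n)|.

Definition num_coprime_fact (n : nat) : nat :=
  #|` fset_set (coprime_factorizations n)|.

Lemma prod_gt1_bound (s : seq nat) : all (fun d => 1 < d) s ->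
  size s < \prod_(d <- s) d /\ all (fun d => d <= \prod_(d <- s) d) s.
Proof.
elim: s => [|a s IHs] /=; first by rewrite big_nil.
case/andP => a1 /IHs[sz al]; rewrite big_cons; set p := \prod_(d <- s) d in sz al *.
have p0 : 0 < p by apply: leq_ltn_trans sz.
split.
  by apply: (@leq_trans (2 * p)); [rewrite mul2n -addnn -addn1 leq_add | rewrite leq_mul2r a1 orbT].
apply/andP; split; first by rewrite leq_pmulr.
by apply: sub_all al => d /leq_trans; apply; rewrite leq_pmull // ltnW.
Qed.

Lemma finite_factorizations (n : nat) :
  0 < n -> finite_set (factorizations n).
Proof.
move=> n0.
pose g (t : {k : 'I_n.+1 & k.-tuple 'I_n.+1}) : {mset nat}%mset :=
  seq_mset [seq val i | i <- tagged t].
apply: (@sub_finite_set _ _ [set` [seq g t | t <- enum {: {k : 'I_n.+1 & k.-tuple 'I_n.+1}}]]);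
  last exact: finite_seq.
move=> s [al pr] /=.
have [sz le] := prod_gt1_bound al; rewrite pr in sz le.
have szk : size (enum_mset s) < n.+1 by apply: ltnW.
pose t := [tuple of [seq inord i : 'I_n.+1 | i <- in_tuple (enum_mset s)]].
apply/mapP; exists (Tagged (fun k : 'I_n.+1 => k.-tuple 'I_n.+1) (t : (Ordinal szk).-tuple _)).
  by rewrite mem_enum.
rewrite /g /= -map_comp -[LHS]seq_mset_id; congr seq_mset.
rewrite -[LHS]map_id; apply/eq_in_map => d /= ds.
by rewrite inordK // ltnS; apply: (allP le).
Qed.

Lemma factorizations1 : factorizations 1 = [set mset0%mset].
Proof.
apply/seteqP; split=> s /=; last first.
  by move=> ->; rewrite /factorizations /= enum_mset0 big_nil.
case=> al pr; have [+ _] := prod_gt1_bound al; rewrite pr ltnS leqn0.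
by rewrite size_mset_eq0 => /eqP.
Qed.

Lemma num_fact1 : num_fact 1 = 1.
Proof. by rewrite /num_fact factorizations1 fset_set1 cardfs1. Qed.

Lemma num_coprime_fact1 : num_coprime_fact 1 = 1.
Proof.
rewrite /num_coprime_fact /coprime_factorizations factorizations1.
rewrite (_ : [set s | _] = [set mset0%mset]) ?fset_set1 ?cardfs1 //.
apply/seteqP; split=> s /=; first by case.
by move=> ->; split=> //; rewrite enum_mset0.
Qed.

Local Open Scope ring_scope.

Definition neg_moment (R : realType) (g : nat -> nat) (beta x : R) : R :=
  \sum_(1 <= n < (Num.truncn x).+1) (g n)%:R `^ (- beta).

Definition log_iter (R : realType) (k : nat) (x : R) : R := iter k (@ln R) x.

(* The expression multiplying [1 + o(1)] in the exponent. *)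
Definition exponent_main (R : realType) (beta x : R) : R :=
  ((1 + beta) * log_iter 2 x * log_iter 3 x `^ beta) `^ (1 + beta)^-1.

(* The real logarithm [ln] is [0] on nonpositive arguments and [`^] is total,
   so the equality is only required for large [x]. *)
Definition moment_asymptotics (R : realType) (g : nat -> nat) (beta : R) : Prop :=
  exists eps : R -> R,
    eps x @[x --> +oo] --> 0 /\
    \forall x \near +oo, neg_moment g beta x =
      x / ln x * expR ((1 + eps x) * exponent_main beta x).

(* Main.v *)
(* [F n] is the number of set partitions of the prime divisors of [n], and
   [f n] coincides with it when [n] is squarefree, so the sums are governed by
   the distribution of [omega n], the number of prime divisors.

   Upper bound: grouping the primes into at most [m] blocks gives
   [F n >= m ^ omega n / m!], hence [\sum F(n)^-b <= m!^b \sum y ^ omega n]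
   with [y = m ^ -b].  Comparing the weights [ln n = \sum_(d %| n) Lambda d]
   with Chebyshev's bound for [psi] gives
   [\sum_(n <= x) y ^ omega n = O (x / ln x * exp (y * \sum_(q <= x) 1 / q))],
   [q] ranging over prime powers, and Mertens' bound evaluates the exponent as
   [y (ln ln x + O(1))].  Then [m] is optimized.

   Lower bound: keep only the squarefree [n <= x] with [K + 1] prime divisors.
   There are at least [x / ln x * (ln ln x - 5 K)^K / K!] of them, up to a
   factor of order [K]: all primes but one are taken below
   [x ^ (1 / (2 K))], and Chebyshev's lower bound counts the last one.  On
   these [n], [f n <= \sum_(j <= K + 1) j ^ (K + 1) / j!].  For the optimal
   [K], which is [o (ln ln x)], both bounds agree. *)
Require Import Defs.
From mathcomp Require Import all_boot all_order all_algebra.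
From mathcomp Require Import all_classical all_reals all_analysis.
From mathcomp Require Import ring lra zify.
Import Order.TTheory GRing.Theory Num.Theory.
Import numFieldNormedType.Exports.
Set Implicit Arguments.
Unset Strict Implicit.
Unset Printing Implicit Defensive.

(** * Factorizations and set partitions *)

Local Open Scope nat_scope.

(** Masks stand for the subsets of a [k]-element list; [map negb b] then selects the complementary
    subset. *)
Fixpoint masks (k : nat) : seq bitseq :=
  if k is k'.+1 then map (cons true) (masks k') ++ map (cons false) (masks k')
  else [:: [::]].

Lemma mem_masks k b : (b \in masks k) = (size b == k).
Proof.
elim: k b => [|k IH] [|c b] //=; rewrite mem_cat.
  by apply/negbTE/negP => /orP[] /mapP[].
rewrite eqSS -IH; apply/orP/idP => [[] /mapP[b' + [_ ->]] //|bk].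
by case: c; [left|right]; apply: map_f.
Qed.

Lemma masks_uniq k : uniq (masks k).
Proof.
elim: k => //= k IH; rewrite cat_uniq !map_inj_uniq ?IH ?andbT /=; try by move=> ? ? [].
by apply/hasPn => _ /mapP[b _ ->]; apply/negP => /mapP[].
Qed.

Lemma sum_masks (A : comPzSemiRingType) (x : A) k :
  (\sum_(b <- masks k) x ^+ count id b = (1 + x) ^+ k)%R.
Proof.
elim: k => [|k IH]; first by rewrite /= big_seq1 !expr0.
rewrite /= big_cat !big_map /= exprS mulrDl mul1r addrC -IH; congr (_ + _)%R.
by rewrite mulr_sumr; apply: eq_bigr => b _; rewrite add1n exprS.
Qed.

Lemma prod_mask_comask b (qs : seq nat) : size b = size qs ->
  (\prod_(d <- mask b qs) d) * (\prod_(d <- mask (map negb b) qs) d) =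
  \prod_(d <- qs) d.
Proof.
elim: qs b => [|q qs IH] [|c b] //=; first by rewrite !big_nil.
by move=> [/IH E]; case: c => /=; rewrite !big_cons -E; [rewrite mulnA|rewrite mulnCA].
Qed.

Lemma coprime_prodr (q : nat) (s : seq nat) :
  coprime q (\prod_(d <- s) d) = all (coprime q) s.
Proof.
elim: s => [|d s IH]; first by rewrite big_nil coprimen1.
by rewrite big_cons coprimeMr IH.
Qed.

(** If the masks first differ at an entry [q], then [q] divides one of the remaining products and is
    coprime to the other. *)
Lemma prod_mask_inj b b' (qs : seq nat) :
  all (fun d => 1 < d) qs -> pairwise coprime qs ->
  size b = size qs -> size b' = size qs ->
  \prod_(d <- mask b qs) d = \prod_(d <- mask b' qs) d -> b = b'.
Proof.
elim: qs b b' => [|q qs IH] [|c b] [|c' b'] //= /andP[q1 al] /andP[cq pw] [sb] [sb'].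
have ncop (b1 b2 : bitseq) :
    q * (\prod_(d <- mask b1 qs) d) <> \prod_(d <- mask b2 qs) d.
  move=> e; have := all_mask b2 cq; rewrite -coprime_prodr -e coprimeMr /coprime.
  by rewrite gcdnn gtn_eqF.
case: c; case: c'; rewrite /= ?big_cons.
- move/eqP; rewrite eqn_pmul2l ?(ltnW q1)// => /eqP e.
  by congr (_ :: _); exact: IH e.
- by move/ncop.
- by move/esym/ncop.
- by move=> e; congr (_ :: _); exact: IH e.
Qed.

Lemma perm_pairwise (T : eqType) (r : rel T) (s t : seq T) :
  symmetric r -> perm_eq s t -> pairwise r s -> pairwise r t.
Proof.
move=> rC; elim: s t => [|x s IH] t; first by rewrite perm_sym => /perm_nilP ->.
move=> pst /=; have xt : x \in t by rewrite -(perm_mem pst) mem_head.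
case/splitPr: xt pst => t1 t2; rewrite perm_sym -cat1s perm_catCA /= perm_cons.
rewrite perm_sym => p /andP[xs ps]; move: xs; rewrite (perm_all _ p) => xs.
move: (IH _ p ps) xs; rewrite !pairwise_cat all_cat /= allrel_consr.
move=> /and3P[-> -> ->] /andP[h1 ->]; rewrite !andbT.
by apply/allP => y /(allP h1); rewrite rC.
Qed.

Lemma prod_gt0 (s : seq nat) : all (fun d => 1 < d) s -> 0 < \prod_(d <- s) d.
Proof. by move/prod_gt1_bound => [] /(leq_ltn_trans (leq0n _)). Qed.

Lemma coprime_masks b (qs : seq nat) : pairwise coprime qs -> size b = size qs ->
  coprime (\prod_(d <- mask (map negb b) qs) d) (\prod_(d <- mask b qs) d).
Proof.
elim: qs b => [|a qs IH] [|c b] //=; rewrite ?big_nil ?coprime1n//.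
move=> /andP[ca pw] [sb]; case: c; rewrite /= big_cons ?coprimeMl ?coprimeMr IH // ?andbT.
  by rewrite coprime_sym coprime_prodr all_mask.
by rewrite coprime_prodr all_mask.
Qed.

Lemma finite_coprime_factorizations n : 0 < n ->
  finite_set (coprime_factorizations n).
Proof.
move=> n0; apply: sub_finite_set (finite_factorizations n0) => s.
by case.
Qed.

Lemma num_coprime_fact_le n : 0 < n -> num_coprime_fact n <= num_fact n.
Proof.
move=> n0; apply/fsubset_leq_card; rewrite -fset_set_sub.
- by move=> s [].
- exact: finite_coprime_factorizations.
- exact: finite_factorizations.
Qed.

(* A factorization of [q * prod qs] is determined by the factors which do not
   involve [q]; they form a factorization of the product of a sublist of [qs]. *)
Definition extend_factorizations (C : nat -> set {mset nat}%mset) (q : nat)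
    (qs : seq nat) : seq {mset nat}%mset :=
  [seq seq_mset (q * \prod_(d <- mask (map negb b) qs) d :: enum_mset s) |
     b <- masks (size qs),
     s <- enum_fset (fset_set (C (\prod_(d <- mask b qs) d)))].

Lemma size_extend_factorizations C q qs :
  size (extend_factorizations C q qs) =
  \sum_(b <- masks (size qs)) #|` fset_set (C (\prod_(d <- mask b qs) d))|.
Proof. by rewrite size_allpairs_dep sumnE big_map. Qed.

(** The factor containing [q] can be read off the multiset, being the only one not coprime to [q].
    Its cofactor determines the mask [b], and the other factors determine [s]. *)
Lemma extend_coprime_factorizations_uniq q qs :
  all (fun d => 1 < d) (q :: qs) -> pairwise coprime (q :: qs) ->
  uniq (extend_factorizations coprime_factorizations q qs).
Proof.
move=> /= /andP[q1 al] /andP[cq pw].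
apply: allpairs_uniq_dep.
- exact: masks_uniq.
- by move=> b _; exact: fset_uniq.
have in_cop b (s : {mset nat}%mset) : b \in masks (size qs) ->
    s \in enum_fset (fset_set (coprime_factorizations (\prod_(d <- mask b qs) d))) ->
    \prod_(d <- s) d = \prod_(d <- mask b qs) d /\ all (coprime q) s.
  move=> _; rewrite in_fset_set; last first.
    by apply/finite_coprime_factorizations/prod_gt0/all_mask.
  rewrite inE => -[[_ e] _]; split=> //.
  by rewrite -coprime_prodr e coprime_prodr all_mask.
have nin e (s : {mset nat}%mset) : all (coprime q) s -> q * e \in s -> False.
  by move=> /allP h /h; rewrite coprimeMr /coprime gcdnn gtn_eqF.
move=> _ _ /allpairsPdep[b [s [hb hs ->]]] /allpairsPdep[b' [s' [hb' hs' ->]]] /= E.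
have [p1 c1] := in_cop _ _ hb hs; have [p2 c2] := in_cop _ _ hb' hs'.
have /eq_seq_msetP pe := E.
set e := \prod_(d <- mask (map negb b) qs) d in E pe.
set e' := \prod_(d <- mask (map negb b') qs) d in E pe.
have ee : e = e'.
  have := perm_mem pe (q * e); rewrite !inE eqxx /= => /esym/orP[/eqP/eqP|/(nin _ _ c2)//].
  by rewrite eqn_pmul2l ?(ltnW q1)// => /eqP.
have eb : b = b'.
  apply: (can_inj (mapK negbK)); apply: (prod_mask_inj (qs := qs)) => //.
  - by rewrite size_map; apply/eqP; rewrite -mem_masks.
  - by rewrite size_map; apply/eqP; rewrite -mem_masks.
have es : s = s'.
  move: pe; rewrite ee perm_cons => /eq_seq_msetP.
  by rewrite !seq_mset_id.
by move: hs hs'; rewrite es eb.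
Qed.

Lemma extend_coprime_factorizations_sub q qs :
  all (fun d => 1 < d) (q :: qs) -> pairwise coprime (q :: qs) ->
  {subset extend_factorizations coprime_factorizations q qs <=
    fset_set (coprime_factorizations (\prod_(d <- q :: qs) d))}.
Proof.
move=> al pw _ /allpairsPdep[b [s [hb hs ->]]].
rewrite in_fset_set; last exact/finite_coprime_factorizations/prod_gt0.
move: al pw => /= /andP[q1 al] /andP[cq pw].
move: hs; rewrite in_fset_set; last first.
  by apply/finite_coprime_factorizations/prod_gt0/all_mask.
rewrite !inE => -[[als ps] pws].
have sb : size b = size qs by apply/eqP; rewrite -mem_masks.
set e := \prod_(d <- mask (map negb b) qs) d.
have pe := perm_eq_seq_mset (q * e :: enum_mset s).
have e0 : 0 < e by apply/prod_gt0/all_mask.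
split; [split|].
- rewrite (perm_all _ pe) /= als andbT.
  by apply: leq_trans q1 _; rewrite leq_pmulr.
- rewrite (perm_big _ pe) /= !big_cons ps -(prod_mask_comask sb) /=.
  by rewrite -/e -mulnA (mulnC e).
- have sy : symmetric coprime by exact: coprime_sym.
  apply: (perm_pairwise sy (s := q * e :: enum_mset s)); first by rewrite perm_sym.
  rewrite /= pws andbT -coprime_prodr ps coprimeMl; apply/andP; split.
    by rewrite coprime_prodr all_mask.
  exact: coprime_masks.
Qed.

(** Induction along the Bell recurrence: the factors without [q] form a coprime factorization of a
    subproduct given by a mask [b]. The induction hypothesis, with [m] in place of [m.+1], bounds
    their number below by [m ^ count id b / m!], and the binomial theorem sums these terms to
    [m.+1 ^ size qs / m!]. *)
Lemma num_coprime_fact_ge (qs : seq nat) m :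
  all (fun d => 1 < d) qs -> pairwise coprime qs ->
  m ^ size qs <= m`! * num_coprime_fact (\prod_(d <- qs) d).
Proof.
have [k] := ubnP (size qs); elim: k qs m => // k IH [|q qs] m.
  by move=> _ _ _; rewrite big_nil num_coprime_fact1 muln1 fact_gt0.
rewrite /= ltnS => sk al pw; case: m => [|m]; first by rewrite exp0n.
have le1 : \sum_(b <- masks (size qs)) num_coprime_fact (\prod_(d <- mask b qs) d)
    <= num_coprime_fact (\prod_(d <- q :: qs) d).
  rewrite -(size_extend_factorizations coprime_factorizations q); apply: uniq_leq_size.
    exact: extend_coprime_factorizations_uniq.
  exact: extend_coprime_factorizations_sub.
rewrite factS expnS -mulnA leq_mul2l /=.
apply: leq_trans (leq_mul (leqnn m`!) le1).
have -> : m.+1 ^ size qs = \sum_(b <- masks (size qs)) m ^ count id b.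
  by rewrite -natrXE -add1n -(sum_masks (m : nat)).
rewrite big_distrr /= big_seq [leqRHS]big_seq; apply: leq_sum => b.
rewrite mem_masks => /eqP sb.
move: al pw => /= /andP[q1 al] /andP[cq pw].
rewrite -(size_mask sb); apply: IH.
- by rewrite size_mask// (leq_ltn_trans (count_size _ _)) // sb.
- exact: all_mask.
- exact: pairwise_mask.
Qed.

Lemma dvdn_prod_primes (qs : seq nat) d : all prime qs -> d %| \prod_(p <- qs) p ->
  exists2 b, size b = size qs & d = \prod_(p <- mask b qs) p.
Proof.
elim: qs d => [|q qs IH] d /=.
  by rewrite big_nil dvdn1 => _ /eqP ->; exists [::]; rewrite ?big_nil.
case/andP => pq al; rewrite big_cons; have [/dvdnP[e ->]|nqd] := boolP (q %| d).
  rewrite mulnC dvdn_pmul2l ?prime_gt0// => /(IH _ al)[b sb ->].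
  by exists (true :: b); rewrite /= ?sb ?big_cons.
rewrite Gauss_dvdr; last by rewrite coprime_sym prime_coprime.
by move/(IH _ al) => [b sb ->]; exists (false :: b); rewrite /= ?sb.
Qed.

Lemma prime_gt1s (qs : seq nat) : all prime qs -> all (fun d => 1 < d) qs.
Proof. by apply: sub_all => p /prime_gt1. Qed.

(** By Euclid's lemma some factor is [q * e]. The product of the others divides that of [qs], hence
    is the product over a mask, and [e] is the product over the complement. *)
Lemma factorizations_sub_extend q qs : all prime (q :: qs) ->
  {subset fset_set (factorizations (\prod_(d <- q :: qs) d)) <=
    extend_factorizations factorizations q qs}.
Proof.
move=> al s; rewrite in_fset_set; last exact/finite_factorizations/prod_gt0/prime_gt1s.
move: al => /= /andP[pq al]; rewrite inE big_cons => -[als ps].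
have qs0 : 0 < \prod_(d <- qs) d by exact/prod_gt0/prime_gt1s.
have [d ds qd] : exists2 d, d \in enum_mset s & q %| d.
  have: q %| \prod_(d <- enum_mset s) d by rewrite ps dvdn_mulr.
  elim: (enum_mset s) => [|a t IH].
    by rewrite big_nil Euclid_dvd1.
  rewrite big_cons Euclid_dvdM// => /orP[qa|/IH[d dt qd]].
    by exists a; rewrite ?mem_head.
  by exists d; rewrite // inE dt orbT.
have pe := perm_to_rem ds; move: (rem _ _) pe => t pe.
have pt : d * \prod_(x <- t) x = q * \prod_(p <- qs) p.
  by rewrite -ps (perm_big _ pe) /= big_cons.
case/dvdnP: qd => e de; subst d; rewrite (mulnC e) in pt pe; rewrite -mulnA in pt.
have pt' : e * \prod_(x <- t) x = \prod_(p <- qs) p.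
  by apply/eqP; rewrite -(eqn_pmul2l (prime_gt0 pq)); apply/eqP.
have [|b sb eb] := @dvdn_prod_primes qs (\prod_(x <- t) x) al.
  by rewrite -pt' dvdn_mull.
apply/allpairsPdep; exists b, (seq_mset t); split.
- by rewrite mem_masks sb.
- rewrite in_fset_set; last first.
    by apply/finite_factorizations/prod_gt0/all_mask/prime_gt1s.
  rewrite inE; split.
    rewrite (perm_all _ (perm_eq_seq_mset t)).
    by move: als; rewrite (perm_all _ pe) /= => /andP[].
  by rewrite (perm_big _ (perm_eq_seq_mset t)).
- rewrite -[LHS]seq_mset_id; apply/eq_seq_msetP; apply: (perm_trans pe).
  suff -> : e = \prod_(d <- mask [seq ~~ i | i <- b] qs) d.
    by rewrite perm_cons perm_sym perm_eq_seq_mset.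
  have t0 : 0 < \prod_(x <- t) x by rewrite eb; apply/prod_gt0/all_mask/prime_gt1s.
  by apply/eqP; rewrite -(eqn_pmul2r t0) pt' -(prod_mask_comask sb) eb mulnC.
Qed.

Local Open Scope ring_scope.

(** The right-hand side is a truncated Dobinski series, without the factor [1 / e]. It satisfies, as
    an inequality, the recurrence that bounds the number of factorizations. *)
Lemma num_fact_primes_le (R : realType) (qs : seq nat) : all prime qs ->
  (num_fact (\prod_(d <- qs) d))%:R <=
  \sum_(j < (size qs).+1) j%:R ^+ size qs / j`!%:R :> R.
Proof.
have [k] := ubnP (size qs); elim: k qs => // k IH [|q qs].
  by move=> _ _; rewrite big_nil num_fact1 /= big_ord1 expr0 divr1.
rewrite /= ltnS => sk al.
have le1 : (num_fact (\prod_(d <- q :: qs) d) <=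
    \sum_(b <- masks (size qs)) num_fact (\prod_(d <- mask b qs) d))%N.
  rewrite -(size_extend_factorizations factorizations q).
  apply: uniq_leq_size; first exact: fset_uniq.
  exact: factorizations_sub_extend.
apply: (le_trans (y := (\sum_(b <- masks (size qs)) num_fact (\prod_(d <- mask b qs) d))%:R)).
  by rewrite ler_nat.
rewrite natr_sum.
apply: (@le_trans _ _ (\sum_(b <- masks (size qs))
    \sum_(j < (size qs).+1) j%:R ^+ count id b / j`!%:R)).
  rewrite big_seq [leRHS]big_seq; apply: ler_sum => b.
  rewrite mem_masks => /eqP sb; move: al => /= /andP[_ al].
  have sm := size_mask sb.
  have cs : (count id b <= size qs)%N by rewrite -sb count_size.
  apply: le_trans (IH (mask b qs) _ _) _.
  - by rewrite sm (leq_ltn_trans cs).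
  - exact: all_mask.
  rewrite sm (big_ord_widen (size qs).+1 (fun j => j%:R ^+ count id b / j`!%:R)) ?ltnS//.
  rewrite big_mkcond /=; apply: ler_sum => j _; by case: ifP.
(* Summing over masks gives [(1 + j) ^ k / j!] with [k = size qs], which equals
   [(j + 1) ^ (k + 1) / (j + 1)!], the term of index [j + 1] on the right; the term of index 0
   vanishes. *)
rewrite exchange_big /= [leRHS]big_ord_recl /= exprS mul0r mul0r add0r.
apply: ler_sum => j _; rewrite -mulr_suml sum_masks.
rewrite /bump /= add1n exprS factS natrM invfM -nat1r mulrACA.
by rewrite mulfV ?mul1r// nat1r pnatr_eq0.
Qed.

(** * Chebyshev and Mertens bounds *)

Lemma sum_multiples (V : nmodType) (d N : nat) (g : nat -> V) : (0 < d)%N ->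
  \sum_(1 <= n < N.+1 | (d %| n)%N) g (n %/ d)%N = \sum_(1 <= m < (N %/ d).+1) g m.
Proof.
move=> d0; elim: N => [|N IH]; first by rewrite div0n !big_geq.
rewrite big_mkcond /= big_nat_recr //= -big_mkcond /= IH divnS//.
by case: ifP => dN; rewrite ?addr0 // ?dN ?add1n [RHS]big_nat_recr.
Qed.

Lemma sum_divisors_swap (V : nmodType) (N : nat) (Phi : nat -> nat -> V) :
  \sum_(1 <= n < N.+1) \sum_(1 <= d < N.+1 | (d %| n)%N) Phi d (n %/ d)%N =
  \sum_(1 <= d < N.+1) \sum_(1 <= m < (N %/ d).+1) Phi d m.
Proof.
rewrite (exchange_big_dep xpredT) //= big_nat [RHS]big_nat.
by apply: eq_bigr => d /andP[d0 _]; rewrite sum_multiples.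
Qed.

Lemma ler_sum_term (R : numDomainType) (P : pred nat) (F : nat -> R) (m n i : nat) :
  (m <= i < n)%N -> P i -> (forall j, (m <= j < n)%N -> P j -> 0 <= F j) ->
  F i <= \sum_(m <= j < n | P j) F j.
Proof.
move=> hi Pi F0; rewrite big_mkcond (bigD1_seq i) ?mem_index_iota ?iota_uniq //= Pi lerDl.
rewrite big_seq_cond sumr_ge0// => j; rewrite mem_index_iota => /andP[hj _].
by case: ifP => // Pj; exact: F0.
Qed.

(** * Prime powers and the von Mangoldt function *)

Lemma primes_eq1 (d q : nat) : primes d = [:: q] ->
  prime q /\ exists2 b, (0 < b)%N & d = (q ^ b)%N.
Proof.
move=> dq; have d0 : (0 < d)%N by case: d dq.
have pq : prime q by have := mem_head q [::]; rewrite -dq mem_primes => /andP[].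
have /p_natP[b db] : q.-nat d.
  apply/(pnatP _ d0) => p pp pd.
  have : p \in primes d by rewrite mem_primes pp d0.
  by rewrite dq inE.
split=> //; exists b => //; case: b db dq => // ->.
by rewrite expn0.
Qed.

Definition vonMangoldt (R : realType) (n : nat) : R :=
  if primes n is [:: p] then ln p%:R else 0.

Lemma vonMangoldt_ge0 (R : realType) n : 0 <= vonMangoldt R n.
Proof.
rewrite /vonMangoldt; case E : (primes n) => [|p [|? ?]] //.
have [pp _] := primes_eq1 E; rewrite ln_ge0 // ler1n; exact: prime_gt0.
Qed.

Lemma vonMangoldt_primeX (R : realType) p a : prime p -> (0 < a)%N ->
  vonMangoldt R (p ^ a) = ln p%:R.
Proof. by move=> pp a0; rewrite /vonMangoldt primesX// primes_prime. Qed.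

(** Among the divisors gained in passing from [m] to [p * m], the only prime power is
    [p ^ (logn p m).+1]: a power of another prime dividing [p * m] already divides [m]. *)
Lemma vonMangoldt_new (R : realType) (p m d : nat) : prime p -> (0 < m)%N ->
  (d %| p * m)%N -> ~~ (d %| m)%N -> d != (p ^ (logn p m).+1)%N ->
  vonMangoldt R d = 0.
Proof.
move=> pp m0 dpm dm; rewrite /vonMangoldt; case E : (primes d) => [|q [|? ?]] //.
have [pq [b b0 db]] := primes_eq1 E.
have [qp|npq] := eqVneq q p; last first.
  move: dm; rewrite -(Gauss_dvdr (n := p)) ?dpm //.
  by rewrite db coprimeXl// prime_coprime// dvdn_prime2.
have p0 := prime_gt0 pp.
move: dpm dm; rewrite db qp !pfactor_dvdn ?muln_gt0 ?p0//.
rewrite lognM// logn_prime// eqxx add1n -ltnNge => h1 h2.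
by rewrite eqn_exp2l ?prime_gt1// eqn_leq h1 h2.
Qed.

(** Induction removing the least prime factor [p] from [n = p * m]: divisors of [m] give [ln m], the
    new ones give [ln p]. *)
Lemma sum_vonMangoldt (R : realType) (n N : nat) : (0 < n <= N)%N ->
  \sum_(1 <= d < N.+1 | (d %| n)%N) vonMangoldt R d = ln n%:R.
Proof.
elim/ltn_ind: n => n IH /andP[n0 nN].
have [n1|n1] := leqP n 1.
  have -> : n = 1%N by apply/eqP; rewrite eqn_leq n1.
  by rewrite ln1 big1 // => d; rewrite dvdn1 => /eqP ->; rewrite /vonMangoldt.
set p := pdiv n; have pp : prime p by exact: pdiv_prime.
have p1 := prime_gt1 pp.
have [m nm] : exists m, n = (p * m)%N.
  by have /dvdnP[m ->] := pdiv_dvd n; exists m; rewrite mulnC.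
have m0 : (0 < m)%N by case: m nm n0 => // ->; rewrite muln0.
have mn : (m < n)%N by rewrite nm -{1}(mul1n m) ltn_pmul2r.
have mN : (m <= N)%N := leq_trans (ltnW mn) nN.
rewrite (bigID (fun d => d %| m)%N) /=.
have -> : \sum_(1 <= d < N.+1 | (d %| n)%N && (d %| m)%N) vonMangoldt R d = ln m%:R.
  rewrite -(IH m) ?m0 ?mN//; apply: eq_bigl => d.
  case dm : (d %| m)%N; rewrite ?andbF // andbT nm dvdn_mull //.
set c := (p ^ (logn p m).+1)%N.
have cn : (c %| n)%N by rewrite nm /c expnS dvdn_pmul2l ?prime_gt0// pfactor_dvdnn.
have c0 : (0 < c)%N by rewrite expn_gt0 prime_gt0.
rewrite big_mkcond (bigD1_seq c) ?iota_uniq //=; last first.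
  by rewrite mem_index_iota c0 ltnS (leq_trans (dvdn_leq n0 cn)).
rewrite cn pfactor_dvdn// ltnn /= vonMangoldt_primeX// big1 ?addr0; last first.
  move=> d dc; case: ifP => // /andP[dn dm].
  by apply: (@vonMangoldt_new _ p m); rewrite -?nm.
by rewrite nm natrM lnM ?posrE ?ltr0n ?(ltnW p1)// addrC.
Qed.

Lemma sum_prime_powers_le (R : realType) (N : nat) (h : nat -> R) :
  (forall d, 0 <= h d) ->
  \sum_(1 <= d < N.+1 | size (primes d) == 1) h d <=
  \sum_(1 <= p < N.+1 | prime p) \sum_(1 <= a < (trunc_log p N).+1) h (p ^ a)%N.
Proof.
move=> h0.
(* The indicator of [d = p ^ a] is inserted; summing over [d] first then collapses it. *)
apply: (@le_trans _ _ (\sum_(1 <= d < N.+1) \sum_(1 <= p < N.+1 | prime p)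
    \sum_(1 <= a < (trunc_log p N).+1 | d == (p ^ a)%N) h d)).
  rewrite big_mkcond big_nat [leRHS]big_nat; apply: ler_sum => d /andP[d0 dN].
  case: ifP => [|_]; last by rewrite !sumr_ge0// => p _; rewrite sumr_ge0.
  case E : (primes d) => [|p [|? ?]] // _.
  have [pp [b b0 db]] := primes_eq1 E.
  have dN' : (d <= N)%N by [].
  apply: (@le_trans _ _ (\sum_(1 <= a < (trunc_log p N).+1 | d == (p ^ a)%N) h d)).
    apply: (@ler_sum_term _ _ (fun=> h d) _ _ b) => //; last by rewrite db.
    by rewrite b0 /= ltnS; apply: trunc_log_max; rewrite ?prime_gt1// -db.
  apply: (@ler_sum_term _ _ (fun p => \sum_(1 <= a < (trunc_log p N).+1 | d == (p ^ a)%N) h d) _ _ p) => //.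
    rewrite prime_gt0//= ltnS (leq_trans _ dN')// db -{1}(expn1 p).
    by rewrite leq_exp2l ?prime_gt1.
  by move=> j _ _; rewrite sumr_ge0.
rewrite (exchange_big_dep prime) //=; apply: ler_sum => p pp.
rewrite (exchange_big_dep xpredT) //=; apply: ler_sum => a _.
rewrite (eq_bigl (fun d => d == (p ^ a)%N)) ?big_nat1_eq; last by move=> d; rewrite pp.
by case: ifP.
Qed.

Definition psi (R : realType) (N : nat) : R := \sum_(1 <= d < N.+1) vonMangoldt R d.

Lemma ln_prod_nat (R : realType) (N : nat) :
  ln (N`!)%:R = \sum_(1 <= n < N.+1) ln n%:R :> R.
Proof.
elim: N => [|N IH]; first by rewrite fact0 ln1 big_geq.
rewrite big_nat_recr //= -IH factS natrM lnM ?posrE ?ltr0n ?fact_gt0//.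
by rewrite addrC.
Qed.

(** Legendre's formula. The quotients vanish for [d > N]; the free upper limit [M] lets [n!] and
    [(2n)!] share one range of summation. *)
Lemma ln_fact (R : realType) (N M : nat) : (N <= M)%N ->
  ln (N`!)%:R = \sum_(1 <= d < M.+1) vonMangoldt R d * (N %/ d)%:R.
Proof.
move=> NM; rewrite (big_cat_nat (n := N.+1)) //= [X in _ = _ + X]big_nat.
rewrite [X in _ = _ + X]big1 ?addr0; last first.
  by move=> d /andP[Nd _]; rewrite divn_small ?mulr0.
rewrite ln_prod_nat; transitivity (\sum_(1 <= n < N.+1)
    \sum_(1 <= d < N.+1 | (d %| n)%N) vonMangoldt R d).
  rewrite big_nat [RHS]big_nat; apply: eq_bigr => n nN.
  by rewrite sum_vonMangoldt.
rewrite (sum_divisors_swap N (fun d _ => vonMangoldt R d)).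
by apply: eq_bigr => d _; rewrite sumr_const_nat subn1 mulr_natr.
Qed.

Lemma double_divn_le n d : ((n %/ d).*2 <= n.*2 %/ d)%N.
Proof.
case: (posnP d) => [->|d0]; first by rewrite !divn0.
by rewrite leq_divRL// -!mul2n -mulnA leq_mul2l leq_divM.
Qed.

(** Legendre's formula for [(2n)! / n!^2]; the truncated subtraction is exact by
    [double_divn_le]. *)
Lemma ln_central_binomial (R : realType) (n : nat) :
  ln ('C(n.*2, n))%:R =
  \sum_(1 <= d < (n.*2).+1) vonMangoldt R d * (n.*2 %/ d - (n %/ d).*2)%:R.
Proof.
have nn : (n <= n.*2)%N by rewrite -addnn leq_addr.
have E := bin_fact nn; have n2 : (n.*2 - n = n)%N by rewrite -addnn addnK.
rewrite n2 in E; have := congr1 (fun k => ln (k%:R : R)) E.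
have f0 := fact_gt0 n.
rewrite !natrM !lnM ?posrE ?mulr_gt0 ?ltr0n ?fact_gt0 ?bin_gt0//.
rewrite (@ln_fact R n.*2 n.*2)// (@ln_fact R n n.*2)// => /eqP.
rewrite eq_sym -subr_eq => /eqP <-; rewrite -big_split -sumrB /=.
apply: eq_bigr => d _; rewrite natrB -?addnn ?natrD; last first.
  by rewrite !addnn double_divn_le.
by rewrite -mulrDr -mulrBr.
Qed.

(** * Chebyshev's bounds from the central binomial coefficient *)

Lemma central_binomial_le n : ('C(n.*2, n) <= 4 ^ n)%N.
Proof.
rewrite (_ : 4 = 2 ^ 2)%N // -expnM mul2n (expnDn 1 1 n.*2).
have h : (n < n.*2.+1)%N by rewrite ltnS -addnn leq_addr.
rewrite (bigD1 (Ordinal h)) //= !exp1n !muln1; exact: leq_addr.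
Qed.

(** Pascal's rule exhibits two copies of [C(2n, n)] inside [C(2n+2, n+1)]. *)
Lemma central_binomial_ge n : (2 ^ n <= 'C(n.*2, n))%N.
Proof.
elim: n => // n IH; rewrite doubleS binS binS expnS mul2n -addnn.
apply: leq_add; first by apply: leq_trans IH _; apply: leq_addl.
by case: n IH => [|n] IH //; rewrite binS (leq_trans IH)// leq_addr.
Qed.

Lemma psiD (R : realType) (n m : nat) : (n <= m)%N ->
  psi R m = psi R n + \sum_(n.+1 <= d < m.+1) vonMangoldt R d.
Proof. by move=> nm; rewrite /psi (big_cat_nat (n := n.+1)). Qed.

Lemma psi_le_mono (R : realType) (n m : nat) : (n <= m)%N -> psi R n <= psi R m.
Proof.
by move=> nm; rewrite (psiD R nm) lerDl sumr_ge0// => *; exact: vonMangoldt_ge0.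
Qed.

(** For [n < d <= 2n] the coefficient of [vonMangoldt R d] in [ln C(2n, n)] is at least 1, so these
    terms cover [psi R n.*2 - psi R n]. *)
Lemma psi_double_le (R : realType) n :
  psi R n.*2 <= psi R n + ln ('C(n.*2, n))%:R.
Proof.
have nn : (n <= n.*2)%N by rewrite -addnn leq_addr.
rewrite (psiD _ nn) lerD2l ln_central_binomial [leRHS](big_cat_nat (n := n.+1)) //=.
rewrite -[leLHS]add0r lerD //.
  by rewrite sumr_ge0// => d _; rewrite mulr_ge0// vonMangoldt_ge0.
rewrite big_nat [leRHS]big_nat; apply: ler_sum => d /andP[nd dn].
rewrite (divn_small nd) subn0 ler_peMr ?vonMangoldt_ge0// ler1n.
by rewrite divn_gt0 // (leq_trans _ nd).
Qed.

Lemma ln_central_binomial_le_psi (R : realType) n :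
  ln ('C(n.*2, n))%:R <= psi R n.*2.
Proof.
rewrite ln_central_binomial /psi big_nat [leRHS]big_nat.
apply: ler_sum => d /andP[d0 _]; rewrite ler_piMr ?vonMangoldt_ge0// -[1]/(1%:R) ler_nat.
rewrite leq_subLR -ltnS ltn_divLR//; have := ltn_ceil n d0.
by rewrite -!mul2n; lia.
Qed.

Lemma ln2_bounds (R : realType) : 1 / 2 <= ln (2 : R) <= 1.
Proof.
have h1 : -1 < -(1/2) :> R by lra.
have := le_ln1Dx h1; rewrite (_ : 1 + - (1/2) = 2^-1 :> R) ?lnV ?posrE//; last by lra.
have h2 : -1 < 1 :> R by lra.
have := le_ln1Dx h2; rewrite (_ : 1 + 1 = 2 :> R) //.
by lra.
Qed.

Lemma ln_nat_ge0 (R : realType) n : 0 <= ln (n%:R : R).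
Proof.
by case: n => [|n]; [rewrite ln0 | rewrite ln_ge0// ler1n].
Qed.

(** Halving: with [n = N./2], the value at [2n] is at most [4n + 2n]. In the odd case the one extra
    term is at most [ln (2n + 1) <= 2n], and [8n <= 4N]. *)
Lemma psi_le (R : realType) N : psi R N <= 4 * N%:R.
Proof.
elim/ltn_ind: N => N IH; have [N1|N1] := leqP N 1.
  case: N N1 IH => [|[|//]] _ _; first by rewrite /psi big_geq// mulr0.
  by rewrite /psi big_nat1 /vonMangoldt /=.
set n := N./2; have nN : (n < N)%N by rewrite /n; lia.
have := psi_double_le R n; have := IH n nN.
have : ln ('C(n.*2, n))%:R <= 2 * n%:R :> R.
  apply: (@le_trans _ _ (ln (4 ^ n)%:R)).
    by rewrite ler_ln ?posrE ?ltr0n ?expn_gt0 ?bin_gt0 -?addnn ?leq_addr// addnn ler_nat central_binomial_le.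
  rewrite natrX lnXn// (_ : 4 = 2 * 2 :> R); last by lra.
  rewrite lnM ?posrE// -[leLHS]mulr_natr ler_wpM2r//.
  by have /andP[_] := ln2_bounds R; lra.
have n0 : 0 <= n%:R :> R by [].
have dn : n.*2%:R = 2 * n%:R :> R by rewrite -mul2n natrM.
have [N0|N0] : N = n.*2 \/ N = n.*2.+1 by rewrite /n; lia.
  by move=> h1 h2 h3; rewrite N0 dn; lra.
move=> h1 h2 h3; rewrite N0 {1}/psi big_nat_recr //= -/(psi R n.*2).
have : vonMangoldt R n.*2.+1 <= n.*2%:R.
  have lnb : ln n.*2.+1%:R <= n.*2%:R :> R.
    by rewrite -nat1r le_ln1Dx// (lt_le_trans (y := 0)).
  apply: le_trans lnb.
  rewrite -(@sum_vonMangoldt R n.*2.+1 n.*2.+1) ?leqnn//.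
  apply: (@ler_sum_term R _ (vonMangoldt R)); rewrite ?ltnS ?leqnn ?dvdnn// => *.
  exact: vonMangoldt_ge0.
rewrite -nat1r dn; lra.
Qed.

(** With [n = N./2], [psi R N] is at least [n ln 2 >= n / 2], and [N <= 3n]. *)
Lemma psi_ge (R : realType) N : (2 <= N)%N -> N%:R / 6 <= psi R N.
Proof.
move=> N2; set n := N./2.
apply: le_trans (psi_le_mono R (_ : n.*2 <= N)%N); last by rewrite /n; lia.
apply: le_trans (ln_central_binomial_le_psi R n).
apply: (@le_trans _ _ (ln (2 ^ n)%:R)); last first.
  by rewrite ler_ln ?posrE ?ltr0n ?expn_gt0 ?bin_gt0 -?addnn ?leq_addr// addnn ler_nat central_binomial_ge.
rewrite natrX lnXn// -[leRHS]mulr_natr; have /andP[h _] := ln2_bounds R.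
have hn : N%:R <= 3 * n%:R :> R by rewrite -natrM ler_nat /n; lia.
have n0 : 0 <= n%:R :> R by [].
nra.
Qed.

(** * Mertens bounds and the prime count *)

Lemma sum_vonMangoldt_div_le (R : realType) (N : nat) : (0 < N)%N ->
  \sum_(1 <= d < N.+1) vonMangoldt R d / d%:R <= ln N%:R + 4.
Proof.
move=> N0; have N0' : 0 < N%:R :> R by rewrite ltr0n.
rewrite -(ler_pM2l N0') mulrDr.
(* Replacing the integer part of [N / d] by [N / d] in Legendre's formula costs at most
   [psi R N <= 4 N]. *)
have h1 : N%:R * (\sum_(1 <= d < N.+1) vonMangoldt R d / d%:R) - psi R N <= ln (N`!)%:R.
  rewrite (ln_fact R (leqnn N)) mulr_sumr /psi -sumrB big_nat [leRHS]big_nat.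
  apply: ler_sum => d /andP[d0 dN].
  have d0' : 0 < d%:R :> R by rewrite ltr0n.
  rewrite mulrCA -{2}[vonMangoldt R d]mulr1 -mulrBr ler_wpM2l ?vonMangoldt_ge0//.
  rewrite lerBlDr ler_pdivrMr// natr1 -natrM ler_nat.
  exact: ltnW (ltn_ceil _ _).
have h2 : ln (N`!)%:R <= N%:R * ln N%:R :> R.
  rewrite ln_prod_nat; apply: (@le_trans _ _ (\sum_(1 <= n < N.+1) ln N%:R)).
    rewrite big_nat [leRHS]big_nat; apply: ler_sum => n /andP[n0 nN].
    by rewrite ler_ln ?posrE ?ltr0n// ler_nat.
  by rewrite sumr_const_nat subn1 mulr_natl.
have := psi_le R N; lra.
Qed.

Lemma ln_le_subr1 (R : realType) (x : R) : 0 < x -> ln x <= x - 1.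
Proof. by move=> x0; rewrite -{1}(subrKC 1 x) le_ln1Dx// ltrBrDl subrr. Qed.

Lemma ln_ln_diff (R : realType) (u v : R) : 0 < v -> v <= u ->
  (u - v) / u <= ln u - ln v.
Proof.
move=> v0 vu; have u0 := lt_le_trans v0 vu.
have := ln_le_subr1 (divr_gt0 v0 u0).
rewrite ln_div ?posrE// mulrBl mulfV ?gt_eqF//; lra.
Qed.

(* Abel summation, run as an induction: with [D n := ln n + 4 - A n >= 0], where
   [A n] is the sum in [sum_vonMangoldt_div_le], the quantity
   [S n + D n / ln n - ln (ln n)] is nonincreasing. *)
Lemma sum_vonMangoldt_div_ln_le (R : realType) (N : nat) : (2 <= N)%N ->
  \sum_(2 <= d < N.+1) vonMangoldt R d / (d%:R * ln d%:R) <= ln (ln N%:R) + 10.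
Proof.
set A := fun N => \sum_(1 <= d < N.+1) vonMangoldt R d / d%:R.
move=> N2; suff: \sum_(2 <= d < N.+1) vonMangoldt R d / (d%:R * ln d%:R)
    + (ln N%:R + 4 - A N) / ln N%:R <= ln (ln N%:R) + 10.
  apply: le_trans; rewrite lerDl divr_ge0 ?ln_nat_ge0// subr_ge0.
  by apply: sum_vonMangoldt_div_le; exact: ltnW.
elim: N N2 => // N IH; rewrite ltnS leq_eqVlt => /predU1P[<-|N2].
  have v2 : vonMangoldt R 2 = ln 2 by exact: (@vonMangoldt_primeX R 2 1).
  have v1 : vonMangoldt R 1 = 0 by [].
  rewrite big_nat1 /A big_nat_recr//= big_nat1 v1 v2 mul0r add0r.
  have /andP[l1 l2] := ln2_bounds R.
  have l0 : 0 < ln 2 :> R by lra.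
  have -> : ln 2 / (2 * ln 2) = 1 / 2 :> R by field; lra.
  have -> : (ln 2 + 4 - ln 2 / 2) / ln 2 = 1 / 2 + 4 / ln 2 :> R by field; lra.
  (* The constant 10 is fixed here: the left side is [1 + 4 / ln 2 <= 9], while
     [ln (ln 2) >= -1]. *)
  have i2 : (ln 2)^-1 <= 2 :> R by rewrite invf_ple ?posrE//; lra.
  have : - ln (ln 2) <= 1 :> R.
    rewrite -lnV ?posrE//; apply: (@le_trans _ _ (ln 2)) => //.
    by rewrite ler_ln ?posrE// invr_gt0.
  lra.
have {IH} := IH N2; set S := \sum_(2 <= d < N.+1) _.
have N0 : (0 < N)%N := ltnW N2.
have hD : A N <= ln N%:R + 4 by exact: sum_vonMangoldt_div_le.
rewrite big_nat_recr ?(ltnW N2)//= -/S.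
have -> : A N.+1 = A N + vonMangoldt R N.+1 / N.+1%:R by rewrite /A big_nat_recr.
have v0 : 0 < ln N%:R :> R by rewrite ln_gt0// ltr1n.
have vu : ln N%:R <= ln N.+1%:R :> R by rewrite ler_ln ?posrE ?ltr0n// ler_nat.
have := ln_ln_diff v0 vu.
set u := ln N.+1%:R in vu *; set v := ln N%:R in v0 vu hD *; set a := vonMangoldt _ _.
have u0 : 0 < u := lt_le_trans v0 vu.
have n0 : N.+1%:R != 0 :> R by rewrite pnatr_eq0.
have -> : a / (N.+1%:R * u) = a / N.+1%:R / u by rewrite invfM mulrA.
set w := a / N.+1%:R => h1 h2.
have h3 : (v + 4 - A N) / u <= (v + 4 - A N) / v.
  by rewrite ler_wpM2l ?subr_ge0// lef_pV2 ?posrE.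
(* The new term [w / u] cancels against the drop in [D]; the remaining [(u - v) / u] is paid for by
   the growth of [ln (ln n)]. *)
rewrite -addrA; have -> : w / u + (u + 4 - (A N + w)) / u = (v + 4 - A N) / u + (u - v) / u.
  by rewrite -!mulrDl; congr (_ / _); ring.
lra.
Qed.

Definition sum_inv_primes (R : realType) (N : nat) : R :=
  \sum_(1 <= p < N.+1 | prime p) p%:R^-1.

Definition sum_inv_prime_powers (R : realType) (N : nat) : R :=
  \sum_(1 <= d < N.+1 | size (primes d) == 1) d%:R^-1.

Lemma sum_inv_primes_le (R : realType) (N : nat) : (2 <= N)%N ->
  sum_inv_primes R N <= ln (ln N%:R) + 10.
Proof.
move=> N2; apply: le_trans (sum_vonMangoldt_div_ln_le R N2).
rewrite /sum_inv_primes big_mkcond big_ltn ?ltnS ?(ltnW N2)// [prime 1]/prime /= add0r.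
rewrite big_nat [leRHS]big_nat; apply: ler_sum => p /andP[p2 _].
have l0 : 0 < ln p%:R :> R by rewrite ln_gt0// ltr1n.
case: ifP => pp; last first.
  by rewrite mulr_ge0 ?vonMangoldt_ge0// invr_ge0 mulr_ge0 // ltW.
have -> : vonMangoldt R p = ln p%:R by rewrite -(expn1 p) vonMangoldt_primeX// expn1.
by rewrite invfM mulrC mulfVK ?gt_eqF.
Qed.

Lemma sum_geometric_le (R : realFieldType) (x : R) k : 1 < x ->
  \sum_(1 <= a < k.+1) (x ^+ a)^-1 <= (x - 1)^-1.
Proof.
move=> x1; have x0 : 0 < x by lra.
suff -> : \sum_(1 <= a < k.+1) (x ^+ a)^-1 = (x - 1)^-1 * (1 - (x ^+ k)^-1).
  by rewrite ler_piMr ?invr_ge0 ?subr_ge0 ?(ltW x1)// gerBl invr_ge0 exprn_ge0// ltW.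
elim: k => [|k IH]; first by rewrite big_geq// expr0 invr1 subrr mulr0.
rewrite big_nat_recr//= IH exprS; have : x ^+ k != 0 by rewrite expf_neq0// gt_eqF.
move: (x ^+ k) => y y0; field; rewrite y0 !gt_eqF//; lra.
Qed.

(** The powers of [p] contribute at most [1 / (p - 1)]. The excess over [1 / p], summed over all
    integers from 2 on, telescopes to at most 1. *)
Lemma sum_inv_prime_powers_le (R : realType) (N : nat) :
  sum_inv_prime_powers R N <= sum_inv_primes R N + 1.
Proof.
apply: (le_trans (sum_prime_powers_le N (h := fun d => d%:R^-1) _)) => //.
apply: (@le_trans _ _ (\sum_(1 <= p < N.+1 | prime p) (p%:R^-1 + (p.-1%:R^-1 - p%:R^-1)))).
  apply: ler_sum => p pp; rewrite subrKC.
  under eq_bigr do rewrite natrX.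
  apply: le_trans (sum_geometric_le _ _) _; first by rewrite ltr1n prime_gt1.
  by rewrite -subn1 natrB ?prime_gt0.
rewrite big_split /= lerD2l.
apply: (@le_trans _ _ (\sum_(1 <= n < N) (n%:R^-1 - n.+1%:R^-1))).
  case: N => [|N]; first by rewrite !big_geq.
  rewrite big_mkcond /= big_ltn //= add0r big_add1 /= big_nat [leRHS]big_nat.
  apply: ler_sum => n /andP[n0 _]; case: ifP => // _.
  by rewrite subr_ge0 lef_pV2 ?posrE ?ltr0n// ler_nat.
case: (posnP N) => [->|N0]; first by rewrite big_geq.
under eq_bigr do rewrite -opprB.
by rewrite sumrN telescope_sumr// opprB invr1 gerBl.
Qed.

Definition prime_count (R : realType) (N : nat) : R := \sum_(1 <= p < N.+1 | prime p) 1.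

(** Each prime [p] contributes [ln p] once per power up to [N], which totals the logarithm of its
    largest power below or equal to [N]. *)
Lemma psi_le_prime_count (R : realType) (N : nat) :
  psi R N <= prime_count R N * ln N%:R.
Proof.
have -> : psi R N = \sum_(1 <= d < N.+1 | size (primes d) == 1) vonMangoldt R d.
  rewrite [RHS]big_mkcond; apply: eq_bigr => d _; case: ifP => //.
  by rewrite /vonMangoldt; case: (primes d) => [|? []].
apply: (le_trans (sum_prime_powers_le N (@vonMangoldt_ge0 R))).
rewrite /prime_count mulr_suml big_nat_cond [leRHS]big_nat_cond.
apply: ler_sum => p /andP[/andP[p0 pN] pp]; rewrite mul1r.
have N0 : (0 < N)%N by rewrite (leq_trans p0).
apply: (@le_trans _ _ (\sum_(1 <= a < (trunc_log p N).+1) ln p%:R)).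
  rewrite big_nat [leRHS]big_nat; apply: ler_sum => a /andP[a0 _].
  by rewrite vonMangoldt_primeX.
rewrite sumr_const_nat subn1 /= -lnXn ?ltr0n// -natrX.
by rewrite ler_ln ?posrE ?ltr0n ?expn_gt0 ?p0// ler_nat trunc_logP// prime_gt1.
Qed.

Lemma prime_count_ge (R : realType) (N : nat) : (2 <= N)%N ->
  N%:R / (6 * ln N%:R) <= prime_count R N.
Proof.
move=> N2; have l0 : 0 < ln N%:R :> R by rewrite ln_gt0// ltr1n.
rewrite invfM mulrA ler_pdivrMr//; apply: le_trans (psi_le_prime_count R N).
exact: psi_ge.
Qed.

(** * Sums over the number of prime divisors *)

(** Both sides run over the pairs with [d * m <= N]. *)
Lemma exchange_hyperbola (V : nmodType) (N : nat) (Phi : nat -> nat -> V) :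
  \sum_(1 <= d < N.+1) \sum_(1 <= m < (N %/ d).+1) Phi d m =
  \sum_(1 <= m < N.+1) \sum_(1 <= d < (N %/ m).+1) Phi d m.
Proof.
have widen (F : nat -> V) d : \sum_(1 <= m < (N %/ d).+1) F m =
    \sum_(1 <= m < N.+1 | (m < (N %/ d).+1)%N) F m.
  by rewrite (big_nat_widen _ _ N.+1)// ltnS leq_div.
under eq_bigr do rewrite widen.
under [RHS]eq_bigr do rewrite widen.
rewrite (exchange_big_dep xpredT) //= big_nat [RHS]big_nat.
apply: eq_bigr => m /andP[m0 _]; rewrite big_nat_cond [RHS]big_nat_cond.
apply: eq_bigl => d; case: (posnP d) => //= d0; congr (_ && _).
by rewrite !ltnS !leq_divRL// mulnC.
Qed.

Definition omega (n : nat) : nat := size (primes n).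

Lemma omega_le n : (omega n <= n)%N.
Proof.
rewrite /omega -[X in (_ <= X)%N](size_iota 1); apply: uniq_leq_size (primes_uniq n) _.
move=> p; rewrite mem_primes mem_iota add1n ltnS => /and3P[pp n0 pn].
by rewrite prime_gt0// dvdn_leq.
Qed.

Lemma omega_mull d m : (0 < d)%N -> (0 < m)%N -> (omega m <= omega (d * m))%N.
Proof.
move=> d0 m0; apply: uniq_leq_size (primes_uniq m) _ => p.
by rewrite !mem_primes muln_gt0 d0 m0 /= => /andP[-> /(dvdn_mull d) ->].
Qed.

Lemma omega_coprime d m : (0 < d)%N -> (0 < m)%N -> coprime d m ->
  omega (d * m) = (omega d + omega m)%N.
Proof.
move=> d0 m0 cop; rewrite /omega -size_cat; apply: perm_size.
apply: uniq_perm; first exact: primes_uniq.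
  rewrite cat_uniq !primes_uniq /= andbT -all_predC; apply/allP => p /= pm.
  apply/negP => pd; move: pm pd; rewrite !mem_primes => /and3P[pp _ pm] /and3P[_ _ pd].
  by have := coprime_dvdl pd cop; rewrite prime_coprime// pm.
by move=> p; rewrite mem_cat primesM.
Qed.

(** For [n = d * m] this says that [d] is the full power of some prime in [n], so that removing [d]
    lowers [omega] by exactly one. *)
Definition unitary_prime_power (d m : nat) := (omega d == 1) && coprime d m.

Lemma omega_unitary d m : (0 < m)%N -> unitary_prime_power d m ->
  omega (d * m) = (omega m).+1.
Proof.
move=> m0 /andP[/eqP d1 cop]; rewrite omega_coprime// ?d1//.
by case: d d1 {cop}.
Qed.

Lemma omega_le_unitary (R : realType) n N : (0 < n <= N)%N ->
  (omega n)%:R <= \sum_(1 <= d < N.+1 | (d %| n)%N)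
    (if unitary_prime_power d (n %/ d) then 1 else 0) :> R.
Proof.
move=> /andP[n0 nN]; rewrite -big_mkcondr big_const_seq iter_addr_0 ler_nat.
rewrite -size_filter /omega -(size_map (fun p => p ^ logn p n)%N (primes n)).
apply: uniq_leq_size.
  rewrite map_inj_in_uniq ?primes_uniq// => p q.
  rewrite !mem_primes => /and3P[pp _ pn] /and3P[pq _ qn] E.
  have lp : (0 < logn p n)%N by rewrite logn_gt0 mem_primes pp n0.
  have : (p %| q ^ logn q n)%N by rewrite -E dvdn_exp.
  by rewrite Euclid_dvdX// dvdn_prime2// => /andP[/eqP].
move=> _ /mapP[p pn ->]; rewrite mem_filter mem_index_iota.
move: (pn); rewrite mem_primes => /and3P[pp _ pdn].
have dn := pfactor_dvdnn p n.
have lp : (0 < logn p n)%N by rewrite logn_gt0.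
rewrite dn /= expn_gt0 prime_gt0//= ltnS (leq_trans (dvdn_leq n0 dn) nN) andbT.
rewrite /unitary_prime_power /omega primesX// primes_prime//= coprimeXl// prime_coprime//.
apply/negP => pq; have : (p ^ (logn p n).+1 %| n)%N.
  by rewrite -[X in (_ %| X)%N](divnK dn) expnS dvdn_mul.
by rewrite pfactor_dvdn// ltnn.
Qed.

(** Each [n] with [k.+1] prime divisors splits as [d * m], with [d] a unitary prime power, in at
    least [k.+1] ways. Dropping coprimality and letting [m] run up to [N] makes the double sum a
    product. *)
Lemma omega_layer_rec (R : realType) (N k : nat) :
  (k.+1)%:R * \sum_(1 <= n < N.+1 | omega n == k.+1) n%:R^-1 <=
  sum_inv_prime_powers R N * \sum_(1 <= n < N.+1 | omega n == k) n%:R^-1.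
Proof.
pose Phi d m : R := if unitary_prime_power d m && (omega m == k) then
  d%:R^-1 * m%:R^-1 else 0.
apply: (@le_trans _ _ (\sum_(1 <= n < N.+1) \sum_(1 <= d < N.+1 | (d %| n)%N) Phi d (n %/ d)%N)).
  rewrite mulr_sumr big_mkcond big_nat [leRHS]big_nat; apply: ler_sum => n /andP[n0 nN].
  case: ifP => [/eqP on|_]; last first.
    by rewrite sumr_ge0// => d _; rewrite /Phi; case: ifP => //; rewrite mulr_ge0.
  rewrite -on; have hn : (0 < n <= N)%N by rewrite n0.
  apply: le_trans (ler_wpM2r _ (omega_le_unitary R hn)) _ => //.
  rewrite mulr_suml big_nat_cond [leRHS]big_nat_cond; apply: ler_sum => d /andP[/andP[d0 _] dn].
  rewrite /Phi; case: ifP => u; last by rewrite mul0r.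
  have E : (d * (n %/ d) = n)%N by rewrite mulnC divnK.
  have q0 : (0 < n %/ d)%N by rewrite divn_gt0// dvdn_leq.
  have -> : omega (n %/ d) == k.
    by rewrite -eqSS -on -(omega_unitary q0 u) E.
  by rewrite /= mul1r -invfM -natrM E.
rewrite sum_divisors_swap /sum_inv_prime_powers mulr_suml [leRHS]big_mkcond.
apply: ler_sum => d _; rewrite mulr_sumr.
apply: (@le_trans _ _ (\sum_(1 <= m < N.+1) Phi d m)).
  rewrite [leRHS](big_cat_nat (n := (N %/ d).+1)) //= ?ltnS ?leq_div// lerDl.
  by rewrite sumr_ge0// => m _; rewrite /Phi; case: ifP => //; rewrite mulr_ge0.
case: ifP => od; last first.
  by rewrite big1 // => m _; rewrite /Phi /unitary_prime_power /omega od.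
rewrite [leRHS]big_mkcond; apply: ler_sum => m _; rewrite /Phi.
by case: (omega m == k); rewrite ?andbF// andbT; case: ifP.
Qed.

Lemma omega_layer_le (R : realType) (N k : nat) :
  \sum_(1 <= n < N.+1 | omega n == k) n%:R^-1 <=
  sum_inv_prime_powers R N ^+ k / k`!%:R.
Proof.
have Q0 : 0 <= sum_inv_prime_powers R N by rewrite sumr_ge0.
elim: k => [|k IH].
  rewrite expr0 divr1; have [N0|N0] := posnP N; first by rewrite N0 big_geq.
  rewrite big_ltn_cond//= invr1 big1_seq ?addr0// => n; rewrite mem_index_iota.
  move=> /andP[]; rewrite /omega size_eq0 => /eqP pn /andP[n2 _].
  have := pi_pdiv n; rewrite n2 => h.
  by have : pdiv n \in primes n by []; rewrite pn.
have k0 : 0 < k.+1%:R :> R by rewrite ltr0n.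
rewrite -(ler_pM2l k0); apply: le_trans (omega_layer_rec R N k) _.
apply: le_trans (ler_wpM2l Q0 IH) _.
have f0 : k`!%:R != 0 :> R by rewrite pnatr_eq0 -lt0n fact_gt0.
rewrite exprS factS natrM; move: (k.+1%:R) k0 => c c0.
by rewrite le_eqVlt; apply/orP; left; apply/eqP; field; rewrite f0 gt_eqF.
Qed.

Lemma exp_partial_sum_le (R : realType) (x : R) n : 0 <= x ->
  \sum_(k < n) x ^+ k / k`!%:R <= expR x.
Proof.
move=> x0; rewrite -(big_mkord xpredT (fun k => x ^+ k / k`!%:R)).
apply: (@nondecreasing_cvgn_le _ (series (exp_coeff x))).
  by apply: nondecreasing_series => i _ _; exact: exp_coeff_ge0.
exact: is_cvg_series_exp_coeff.
Qed.

(** Sorting by [omega n] turns the layer bounds into a partial sum of the exponential series;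
    [omega n <= n] makes the layers beyond [N] empty. *)
Lemma sum_omega_div_le (R : realType) (N : nat) (y : R) : 0 <= y ->
  \sum_(1 <= n < N.+1) y ^+ omega n / n%:R <= expR (y * sum_inv_prime_powers R N).
Proof.
move=> y0; have Q0 : 0 <= sum_inv_prime_powers R N by rewrite sumr_ge0.
apply: le_trans (exp_partial_sum_le N.+1 (mulr_ge0 y0 Q0)).
apply: (@le_trans _ _ (\sum_(k < N.+1) y ^+ k * \sum_(1 <= n < N.+1 | omega n == k) n%:R^-1)).
  under [leRHS]eq_bigr do rewrite mulr_sumr.
  rewrite [leRHS](exchange_big_dep xpredT)//= big_nat [leRHS]big_nat.
  apply: ler_sum => n /andP[n0 nN].
  have on : (omega n < N.+1)%N by rewrite (leq_ltn_trans (omega_le n)).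
  by rewrite (bigD1 (Ordinal on)) //= lerDl sumr_ge0// => i _; rewrite mulr_ge0 ?exprn_ge0.
apply: ler_sum => k _; rewrite exprMn -mulrA ler_wpM2l ?exprn_ge0//.
exact: omega_layer_le.
Qed.

(** Split [ln N = ln n + ln (N / n)]. In the first part [ln n] is a divisor sum,
    [y ^ omega n <= y ^ omega (n / d)] because [y <= 1], and Chebyshev's bound gives the constant 4.
    In the second, [ln (N / n) <= N / n] gives 1 more. *)
Lemma sum_omega_le (R : realType) (N : nat) (y : R) : 0 <= y <= 1 ->
  (\sum_(1 <= n < N.+1) y ^+ omega n) * ln N%:R <=
  5 * N%:R * expR (y * sum_inv_prime_powers R N).
Proof.
move=> /andP[y0 y1]; have [->|N0] := posnP N.
  by rewrite big_geq// mul0r mulr0 mul0r.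
apply: (@le_trans _ _ (5 * N%:R * \sum_(1 <= n < N.+1) y ^+ omega n / n%:R)); last first.
  by rewrite ler_wpM2l ?mulr_ge0// sum_omega_div_le.
have h1 : \sum_(1 <= n < N.+1) y ^+ omega n * ln n%:R <=
    4 * N%:R * \sum_(1 <= n < N.+1) y ^+ omega n / n%:R.
  apply: (@le_trans _ _ (\sum_(1 <= n < N.+1) \sum_(1 <= d < N.+1 | (d %| n)%N)
      (vonMangoldt R d * y ^+ omega (n %/ d)%N))).
    rewrite big_nat [leRHS]big_nat; apply: ler_sum => n /andP[n0 nN].
    rewrite -(@sum_vonMangoldt R n N) ?n0// mulr_sumr.
    rewrite big_nat_cond [leRHS]big_nat_cond; apply: ler_sum => d /andP[/andP[d0 _] dn].
    rewrite mulrC ler_wpM2l ?vonMangoldt_ge0// ler_wiXn2l//.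
    by rewrite -[X in (_ <= omega X)%N](divnK dn) mulnC omega_mull// divn_gt0// dvdn_leq.
  rewrite (sum_divisors_swap N (fun d m => vonMangoldt R d * y ^+ omega m)).
  rewrite exchange_hyperbola mulr_sumr big_nat [leRHS]big_nat.
  apply: ler_sum => m /andP[m0 mN]; rewrite -mulr_suml -/(psi R _).
  rewrite mulrCA [leLHS]mulrC ler_wpM2l ?exprn_ge0//.
  apply: le_trans (psi_le _ _) _; rewrite -mulrA ler_wpM2l//.
  by rewrite ler_pdivlMr ?ltr0n// -natrM ler_nat leq_divM.
have h2 : \sum_(1 <= n < N.+1) y ^+ omega n * (ln N%:R - ln n%:R) <=
    N%:R * \sum_(1 <= n < N.+1) y ^+ omega n / n%:R.
  rewrite mulr_sumr big_nat [leRHS]big_nat; apply: ler_sum => n /andP[n0 nN].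
  rewrite mulrCA ler_wpM2l ?exprn_ge0// -ln_div ?posrE ?ltr0n//.
  by rewrite ltW// ln_sublinear// divr_gt0 ?ltr0n.
move: h2; under eq_bigr do rewrite mulrBr.
rewrite sumrB -mulr_suml; lra.
Qed.

(** * Squarefree integers with a given number of prime divisors *)

Definition squarefree_omega (k n : nat) :=
  (\prod_(p <- primes n) p == n) && (omega n == k).

Definition smooth (z n : nat) := all (fun p => p <= z)%N (primes n).

Lemma perm_primes_mul p m : prime p -> (0 < m)%N -> ~~ (p %| m)%N ->
  perm_eq (primes (p * m)) (p :: primes m).
Proof.
move=> pp m0 pm; apply: uniq_perm; first exact: primes_uniq.
  by rewrite /= primes_uniq andbT mem_primes pp m0.
by move=> q; rewrite primesM ?(prime_gt0 pp)// primes_prime// inE.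
Qed.

Lemma squarefree_omega_mul k p m : prime p -> (0 < m)%N -> ~~ (p %| m)%N ->
  squarefree_omega k m -> squarefree_omega k.+1 (p * m).
Proof.
move=> pp m0 pm /andP[/eqP sm /eqP om]; have pe := perm_primes_mul pp m0 pm.
by rewrite /squarefree_omega (perm_big _ pe) /= big_cons sm eqxx /omega (perm_size pe) /= -/(omega m) om eqxx.
Qed.

(** A squarefree [n] with [k.+1] primes arises as [d * m] at most once per prime divisor. The weight
    [w] serves both reciprocals of smooth integers and plain counting. *)
Lemma sum_squarefree_mul_le (R : realType) (N k : nat) (w : nat -> R) :
  (forall n, 0 <= w n) ->
  \sum_(1 <= m < N.+1 | squarefree_omega k m)
    \sum_(1 <= d < (N %/ m).+1 | prime d && ~~ (d %| m)%N) w (d * m)%N <=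
  k.+1%:R * \sum_(1 <= n < N.+1 | squarefree_omega k.+1 n) w n.
Proof.
move=> w0.
pose Phi d m : R := if [&& prime d, ~~ (d %| m)%N & squarefree_omega k m]
  then w (d * m)%N else 0.
have -> : \sum_(1 <= m < N.+1 | squarefree_omega k m)
    \sum_(1 <= d < (N %/ m).+1 | prime d && ~~ (d %| m)%N) w (d * m)%N =
    \sum_(1 <= m < N.+1) \sum_(1 <= d < (N %/ m).+1) Phi d m.
  rewrite big_mkcond; apply: eq_bigr => m _; rewrite /Phi.
  case: ifP => sm; last by rewrite big1// => d _; rewrite !andbF.
  by rewrite big_mkcond; apply: eq_bigr => d _; rewrite andbT.
rewrite -exchange_hyperbola -sum_divisors_swap mulr_sumr [leRHS]big_mkcond /=.
rewrite big_nat [leRHS]big_nat; apply: ler_sum => n /andP[n0 nN].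
case: ifP => sn.
  apply: (@le_trans _ _ (\sum_(1 <= d < N.+1 | (d %| n)%N && prime d) w n)).
    rewrite big_mkcond [leRHS]big_mkcond; apply: ler_sum => d _.
    case: (boolP (d %| n)%N) => //= dn; rewrite /Phi; case: (prime d) => //=.
    by case: ifP => // _; rewrite mulnC divnK.
  rewrite big_const_seq iter_addr_0 -[leLHS]mulr_natl ler_wpM2r// ler_nat.
  move/andP: sn => [_ /eqP <-]; rewrite -size_filter.
  apply: uniq_leq_size; first by rewrite filter_uniq// iota_uniq.
  by move=> d; rewrite mem_filter => /andP[/andP[dn pd] _]; rewrite mem_primes pd n0.
rewrite big1 // => d dn; rewrite /Phi; case: ifP => // /and3P[pd ndn sq].
have q0 : (0 < n %/ d)%N by rewrite divn_gt0 ?prime_gt0// dvdn_leq.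
by have := squarefree_omega_mul pd q0 ndn sq; rewrite mulnC divnK// sn.
Qed.

Lemma sum_primes_ndvd_ge (R : realType) (t k m : nat) (v : nat -> R) :
  (0 < m)%N -> omega m = k -> (forall p, (0 < p)%N -> 0 <= v p <= 1) ->
  \sum_(1 <= p < t.+1 | prime p) v p - k%:R <=
  \sum_(1 <= p < t.+1 | prime p && ~~ (p %| m)%N) v p.
Proof.
move=> m0 om v01; rewrite (bigID (fun p => p %| m)%N) /= lerBlDr addrC lerD2l.
apply: (@le_trans _ _ (\sum_(1 <= p < t.+1 | prime p && (p %| m)%N) 1)).
  rewrite big_nat_cond [leRHS]big_nat_cond; apply: ler_sum => p /andP[/andP[p0 _] _].
  by have /andP[] := v01 _ p0.
rewrite big_const_seq iter_addr_0 -om ler_nat -size_filter.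
apply: uniq_leq_size; first by rewrite filter_uniq// iota_uniq.
by move=> d; rewrite mem_filter => /andP[/andP[pd dn] _]; rewrite mem_primes pd m0.
Qed.

(** The elementary symmetric polynomial of degree [k] in the reciprocals of the primes up to [z]; a
    product of [k] such primes is at most [z ^ k]. *)
Definition elem_sum (R : realType) (z k : nat) : R :=
  \sum_(1 <= m < (z ^ k).+1 | squarefree_omega k m && smooth z m) m%:R^-1.

(** A new prime up to [z] is adjoined to [m]; excluding the [k] primes of [m] removes at most [k]
    from the sum of reciprocals. *)
Lemma elem_sum_rec (R : realType) (z k : nat) : (0 < z)%N ->
  (sum_inv_primes R z - k%:R) * elem_sum R z k <= k.+1%:R * elem_sum R z k.+1.
Proof.
move=> z0; set N := (z ^ k.+1)%N.
pose w n : R := if smooth z n then n%:R^-1 else 0.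
have w0 n : 0 <= w n by rewrite /w; case: ifP.
have -> : elem_sum R z k.+1 = \sum_(1 <= n < N.+1 | squarefree_omega k.+1 n) w n.
  by rewrite /elem_sum big_mkcondr.
apply: le_trans (sum_squarefree_mul_le N k w0).
have kN : (z ^ k <= N)%N by rewrite /N expnS leq_pmull.
apply: (@le_trans _ _ (\sum_(1 <= m < (z ^ k).+1 | squarefree_omega k m)
    \sum_(1 <= d < (N %/ m).+1 | prime d && ~~ (d %| m)%N) w (d * m)%N)); last first.
  rewrite [leRHS](big_cat_nat (n := (z ^ k).+1)) //= lerDl.
  by rewrite sumr_ge0// => m _; rewrite sumr_ge0.
rewrite /elem_sum mulr_sumr big_mkcondr big_nat_cond [leRHS]big_nat_cond.
apply: ler_sum => m /andP[/andP[m0 mN] sq].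
case: ifP => sm; last by rewrite sumr_ge0.
have zN : (z <= N %/ m)%N by rewrite leq_divRL// /N expnS leq_mul.
apply: (@le_trans _ _ (\sum_(1 <= d < z.+1 | prime d && ~~ (d %| m)%N) w (d * m)%N)); last first.
  by rewrite [leRHS](big_cat_nat (n := z.+1)) //= lerDl sumr_ge0.
have -> : \sum_(1 <= d < z.+1 | prime d && ~~ (d %| m)%N) w (d * m)%N =
    (\sum_(1 <= d < z.+1 | prime d && ~~ (d %| m)%N) d%:R^-1) * m%:R^-1.
  rewrite mulr_suml big_nat_cond [RHS]big_nat_cond; apply: eq_bigr => d.
  move=> /andP[/andP[_ dz] /andP[pd dm]].
  rewrite /w /smooth (perm_all _ (perm_primes_mul pd m0 dm)) /= -ltnS dz.
  by rewrite -/(smooth z m) sm natrM invfM.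
rewrite ler_wpM2r// /sum_inv_primes sum_primes_ndvd_ge//; first by case/andP: sq => _ /eqP.
by move=> p p0; rewrite invr_ge0 ler0n invf_le1 ?ltr0n// ler1n.
Qed.

Lemma elem_sum_ge (R : realType) (z K : nat) : (0 < z)%N ->
  K%:R <= sum_inv_primes R z ->
  (sum_inv_primes R z - K%:R) ^+ K / K`!%:R <= elem_sum R z K.
Proof.
move=> z0; set P := sum_inv_primes R z => PK.
(* The loss is kept at [K] for every [k <= K], so that iterating the recurrence yields a pure
   power. *)
suff h k : (k <= K)%N -> (P - K%:R) ^+ k / k`!%:R <= elem_sum R z k by exact: h.
elim: k => [|k IH] kK.
  rewrite expr0 divr1 /elem_sum expn0 big_mkcond big_nat1.
  by rewrite /squarefree_omega /smooth /= big_nil /= invr1.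
have k0 : 0 < k.+1%:R :> R by rewrite ltr0n.
rewrite -(ler_pM2l k0); apply: le_trans (elem_sum_rec R k z0).
rewrite -/P; have PK0 : 0 <= P - K%:R by rewrite subr_ge0.
apply: (@le_trans _ _ ((P - K%:R) * elem_sum R z k)); last first.
  rewrite ler_wpM2r ?lerD2l ?lerN2 ?ler_nat ?(ltnW kK)//.
  by rewrite sumr_ge0.
apply: le_trans (ler_wpM2l PK0 (IH (ltnW kK))).
have f0 : k`!%:R != 0 :> R by rewrite pnatr_eq0 -lt0n fact_gt0.
rewrite exprS factS natrM; move: (k.+1%:R) k0 => c c0.
by rewrite le_eqVlt; apply/orP; left; apply/eqP; field; rewrite f0 gt_eqF.
Qed.

Lemma ln_le_harmonic (R : realType) n :
  ln n.+1%:R <= \sum_(1 <= i < n.+1) i%:R^-1 :> R.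
Proof.
elim: n => [|n IH]; first by rewrite ln1 big_geq.
rewrite big_nat_recr//=; apply: le_trans (lerD IH (lexx _)).
have n0 : 0 < n.+1%:R :> R by rewrite ltr0n.
rewrite -lerBlDl -ln_div ?posrE ?ltr0n//.
have -> : n.+2%:R / n.+1%:R = 1 + n.+1%:R^-1 :> R.
  by rewrite -nat1r mulrDl mulfV ?gt_eqF// mul1r addrC.
by rewrite le_ln1Dx// (lt_le_trans (y := 0))// invr_ge0.
Qed.

(** At [y = 1], [sum_omega_div_le] bounds the harmonic sum, hence [ln z], by the exponential of the
    sum over prime powers; that sum exceeds the one over primes by at most 1. *)
Lemma sum_inv_primes_ge (R : realType) z : (2 <= z)%N ->
  ln (ln z%:R) - 1 <= sum_inv_primes R z.
Proof.
move=> z2; have l0 : 0 < ln z%:R :> R by rewrite ln_gt0// ltr1n.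
rewrite lerBlDr; apply: le_trans (sum_inv_prime_powers_le R z).
rewrite -[leRHS]expRK ler_ln ?posrE ?expR_gt0//.
apply: (@le_trans _ _ (ln z.+1%:R)).
  by rewrite ler_ln ?posrE ?ltr0n ?ler_nat// ltnW.
apply: le_trans (ln_le_harmonic R z) _.
have := @sum_omega_div_le R z 1 ler01; rewrite mul1r.
by under eq_bigr do rewrite expr1n mul1r.
Qed.

Definition squarefree_count (R : realType) (N k : nat) : R :=
  \sum_(1 <= n < N.+1 | squarefree_omega k n) 1.

(** To each smooth [m <= z ^ K] a prime up to [t = N %/ m] is adjoined. Since [t >= N / (2 m)], at
    least [N / (12 m ln N)] primes are available; half of this amount pays for the at most [K]
    primes dividing [m]. *)
Lemma squarefree_count_ge (R : realType) (N z K : nat) : (0 < z)%N ->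
  (z ^ K * 2 <= N)%N -> 24 * K%:R * ln N%:R * (z ^ K)%:R <= N%:R :> R ->
  N%:R / (24 * ln N%:R) * elem_sum R z K <= K.+1%:R * squarefree_count R N K.+1.
Proof.
move=> z0 zN hK; have zK0 : (0 < z ^ K)%N by rewrite expn_gt0 z0.
have N2 : (2 <= N)%N by rewrite (leq_trans _ zN)// -[X in (X <= _)%N]mul1n leq_mul2r.
have lN0 : 0 < ln N%:R :> R by rewrite ln_gt0// ltr1n.
have N0 : 0 < N%:R :> R by rewrite ltr0n ltnW.
apply: le_trans (@sum_squarefree_mul_le R N K (fun=> 1) _) => //.
rewrite /elem_sum mulr_sumr.
apply: (@le_trans _ _ (\sum_(1 <= m < (z ^ K).+1 | squarefree_omega K m)
    \sum_(1 <= d < (N %/ m).+1 | prime d && ~~ (d %| m)%N) 1)); last first.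
  rewrite [leRHS](big_cat_nat (n := (z ^ K).+1)) //=.
    by rewrite lerDl sumr_ge0// => m _; rewrite sumr_ge0.
  by rewrite ltnS (leq_trans _ zN)// leq_pmulr.
rewrite big_mkcondr big_nat_cond [leRHS]big_nat_cond.
apply: ler_sum => m /andP[/andP[m0 mz] sq].
case: ifP => _; last by rewrite sumr_ge0.
have /andP[_ /eqP om] := sq.
apply: le_trans (sum_primes_ndvd_ge _ m0 om _); last by move=> *; rewrite ler01 lexx.
set t := (N %/ m)%N.
have t2 : (2 <= t)%N by rewrite leq_divRL// mulnC (leq_trans _ zN)// leq_mul2r.
apply: (@le_trans _ _ (t%:R / (6 * ln t%:R) - K%:R)); last by rewrite lerB// prime_count_ge.
have tN : (t <= N)%N by exact: leq_div.
have lt0 : 0 < ln t%:R :> R by rewrite ln_gt0// ltr1n.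
have m0' : 0 < m%:R :> R by rewrite ltr0n.
have ht : N%:R / m%:R / 2 <= t%:R :> R.
  rewrite ler_pdivrMr// ler_pdivrMr// -!natrM ler_nat.
  by have := ltn_ceil N m0; rewrite -/t; nia.
have llt : ln t%:R <= ln N%:R :> R by rewrite ler_ln ?posrE ?ltr0n ?ler_nat// ltnW.
have h1 : N%:R / m%:R / 2 / (6 * ln N%:R) <= t%:R / (6 * ln t%:R) :> R.
  apply: ler_pM => //; rewrite ?invr_ge0 ?mulr_ge0 ?invr_ge0 ?(ltW lN0)//.
  by rewrite lef_pV2 ?posrE ?mulr_gt0// ler_wpM2l.
have h2 : K%:R <= N%:R / (24 * ln N%:R) / m%:R :> R.
  rewrite !ler_pdivlMr ?mulr_gt0//; apply: le_trans hK.
  have -> : K%:R * m%:R * (24 * ln N%:R) = 24 * K%:R * ln N%:R * m%:R :> R by ring.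
  by rewrite ler_wpM2l ?ler_nat// !mulr_ge0// ltW.
have E : N%:R / m%:R / 2 / (6 * ln N%:R) =
   N%:R / (24 * ln N%:R) / m%:R + N%:R / (24 * ln N%:R) / m%:R :> R.
  by field; rewrite !gt_eqF.
rewrite E in h1; lra.
Qed.

(** * Explicit bounds for the negative moments *)

(** The full prime powers in [n] are pairwise coprime with product [n]. *)
Lemma num_coprime_fact_omega n m : (0 < n)%N ->
  (m ^ omega n <= m`! * num_coprime_fact n)%N.
Proof.
move=> n0; set qs := [seq (p ^ logn p n)%N | p <- primes n].
have nqs : n = (\prod_(d <- qs) d)%N.
  by rewrite big_map {1}(prod_prime_decomp n0) prime_decompE big_map.
have -> : omega n = size qs by rewrite size_map.
rewrite [X in num_coprime_fact X]nqs; apply: num_coprime_fact_ge.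
  apply/allP => _ /mapP[p pn ->]; rewrite -(expn0 p) ltn_exp2l.
    by rewrite logn_gt0.
  by apply: prime_gt1; move: pn; rewrite mem_primes => /andP[].
rewrite pairwise_map; have := primes_uniq n; rewrite uniq_pairwise.
apply: (sub_in_pairwise (P := [in primes n])); last by apply/allP.
move=> p q pn qn /= npq.
have /andP[pp _] : prime p && ((0 < n)%N && (p %| n)%N) by rewrite -mem_primes.
have /andP[pq _] : prime q && ((0 < n)%N && (q %| n)%N) by rewrite -mem_primes.
by apply/coprimeXl/coprimeXr; rewrite prime_coprime// dvdn_prime2.
Qed.

Lemma num_coprime_fact_gt0 n : (0 < n)%N -> (0 < num_coprime_fact n)%N.
Proof.
by move=> n0; have := num_coprime_fact_omega 1 n0; rewrite exp1n mul1n.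
Qed.

Definition bell_bound (R : realType) (k : nat) : R :=
  \sum_(j < k.+1) j%:R ^+ k / j`!%:R.

Lemma num_fact_squarefree_le (R : realType) k n : squarefree_omega k n ->
  (num_fact n)%:R <= bell_bound R k.
Proof.
move=> /andP[/eqP sn /eqP <-]; rewrite -[X in num_fact X]sn.
apply: num_fact_primes_le; apply/allP => p; rewrite mem_primes.
by case/andP.
Qed.

(** The single term [j ^ j / j!] of the series for [expR j] is at most the whole. *)
Lemma inv_fact_le (R : realType) (j : nat) : (0 < j)%N ->
  (j`!%:R)^-1 <= expR (j%:R - j%:R * ln j%:R) :> R.
Proof.
move=> j0; have j0' : 0 < j%:R :> R by rewrite ltr0n.
have f0 : 0 < j`!%:R :> R by rewrite ltr0n fact_gt0.
have := @exp_partial_sum_le R j%:R j.+1 (ltW j0').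
rewrite (bigD1 ord_max)//= => h.
have {h} : j%:R ^+ j / j`!%:R <= expR j%:R :> R.
  by apply: le_trans h; rewrite lerDl sumr_ge0.
rewrite expRB expRM_natl lnK ?posrE// => h.
by rewrite ler_pdivlMr ?exprn_gt0// mulrC.
Qed.

(* The exponent [k ln j - j ln j + j] is concave in [j]; the bound is its tangent
   line at [j = T]. *)
Lemma bell_bound_le (R : realType) (k : nat) (T : R) : 1 <= T -> k%:R <= T * ln T ->
  bell_bound R k <= k.+1%:R * expR (k%:R * ln T - k%:R + T).
Proof.
move=> T1 kT; have T0 : 0 < T by lra.
rewrite mulr_natl -[X in _ *+ X](card_ord k.+1) -sumr_const; apply: ler_sum => j _.
have [->|j0] := posnP j.
  case: k kT j => [|k] _ _; last by rewrite exprS !mul0r expR_ge0.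
  rewrite expr0 mul1r invr1 mul0r subr0 add0r -{1}expR0 ler_expR; lra.
have j0' : 0 < (j : nat)%:R :> R by rewrite ltr0n.
apply: le_trans (ler_wpM2l _ (inv_fact_le R j0)) _; first exact: exprn_ge0.
rewrite -[X in X ^+ k]lnK ?posrE// -expRM_natl -expRD ler_expR.
set J := (j : nat)%:R in j0' *; set u := ln J; set v := ln T in kT *.
have h1 : u - v <= J / T - 1.
  by rewrite /u /v -ln_div ?posrE// ln_le_subr1// divr_gt0.
have h2 : v - u <= T / J - 1.
  by rewrite /u /v -ln_div ?posrE// ln_le_subr1// divr_gt0.
have h3 : J * (v - u) <= T - J.
  by apply: le_trans (ler_wpM2l (ltW j0') h2) _; rewrite mulrBr mulr1 mulrC divfK ?gt_eqF.
have h4 : k%:R * (u - v) <= k%:R * (J / T - 1) by rewrite ler_wpM2l.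
(* The maximum lies where [j ln j = k]; at or beyond that point [k / T <= ln T], which is all that
   is used. *)
have h5 : k%:R * (J / T) <= J * v.
  rewrite mulrA ler_pdivrMr// -mulrA (mulrC v) [leLHS]mulrC ler_wpM2l//; exact: ltW.
lra.
Qed.

Lemma powRN_anti (R : realType) (b x y : R) : 0 <= b -> 0 < x -> x <= y ->
  y `^ (- b) <= x `^ (- b).
Proof.
move=> b0 x0 xy; have y0 := lt_le_trans x0 xy.
rewrite !powRN lef_pV2 ?posrE ?powR_gt0//.
by apply: ge0_ler_powR => //; rewrite nnegrE ltW.
Qed.

Lemma neg_moment_num_fact_le (R : realType) (b x : R) : 0 <= b ->
  neg_moment num_fact b x <= neg_moment num_coprime_fact b x.
Proof.
move=> b0; rewrite /neg_moment big_nat [leRHS]big_nat; apply: ler_sum => n /andP[n0 _].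
by apply: powRN_anti => //; rewrite ?ltr0n ?ler_nat ?num_coprime_fact_gt0 ?num_coprime_fact_le.
Qed.

Lemma ln_fact_le (R : realType) m : ln (m`!)%:R <= m%:R * ln m%:R :> R.
Proof.
rewrite ln_prod_nat; apply: (@le_trans _ _ (\sum_(1 <= n < m.+1) ln m%:R)).
  rewrite big_nat [leRHS]big_nat; apply: ler_sum => n /andP[n0 nN].
  by rewrite ler_ln ?posrE ?ltr0n ?ler_nat// (leq_trans n0).
by rewrite sumr_const_nat subn1 mulr_natl.
Qed.

Lemma truncn_bounds (R : realType) (x : R) (N := Num.truncn x) : 4 <= x ->
  [/\ (2 <= N)%N, N%:R <= x, x <= 2 * N%:R, ln N%:R <= ln x & ln x <= 2 * ln N%:R].
Proof.
move=> x4; have x0 : 0 <= x by lra.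
have /andP[Nx xN] := truncn_itv x0; rewrite -/N in Nx xN.
have N4 : (4 <= N)%N by rewrite /N truncn_ge_nat.
have N0 : 4 <= N%:R :> R by rewrite (ler_nat _ 4).
rewrite -nat1r in xN.
split=> //.
- exact: leq_trans N4.
- lra.
- by rewrite ler_ln ?posrE//; lra.
- rewrite mulr_natl -lnXn; last lra.
  by rewrite ler_ln ?posrE ?exprn_gt0//; try lra; nra.
Qed.

Lemma neg_moment_num_coprime_fact_le (R : realType) (b x : R) (m : nat) :
  0 < b -> 4 <= x -> (0 < m)%N ->
  neg_moment num_coprime_fact b x <= x / ln x *
    expR (9 + b * (m%:R * ln m%:R) + expR (- b * ln m%:R) * (ln (ln x) + 11)).
Proof.
move=> b0 x4 m0; have [N2 Nx xN lNx lxN] := truncn_bounds x4.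
rewrite /neg_moment; set N := Num.truncn x in N2 Nx xN lNx lxN *.
have lN0 : 0 < ln N%:R :> R by rewrite ln_gt0// ltr1n.
have m0' : 0 < m%:R :> R by rewrite ltr0n.
have m1' : 1 <= m%:R :> R by rewrite ler1n.
set y := expR (- b * ln m%:R).
have y0 : 0 <= y by exact: expR_ge0.
have y1 : y <= 1 by rewrite /y -[leRHS]expR0 ler_expR mulNr oppr_le0 mulr_ge0 ?ln_ge0// ltW.
have h1 : \sum_(1 <= n < N.+1) (num_coprime_fact n)%:R `^ (- b) <=
    expR (b * (m%:R * ln m%:R)) * \sum_(1 <= n < N.+1) y ^+ omega n.
  rewrite mulr_sumr big_nat [leRHS]big_nat; apply: ler_sum => n /andP[n0 _].
  have F0 : 0 < (num_coprime_fact n)%:R :> R by rewrite ltr0n num_coprime_fact_gt0.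
  rewrite /powR gt_eqF// -expRM_natl -expRD ler_expR.
  have : (m ^ omega n)%:R <= (m`! * num_coprime_fact n)%:R :> R.
    by rewrite ler_nat num_coprime_fact_omega.
  rewrite natrX natrM -ler_ln ?posrE ?exprn_gt0// ?mulr_gt0 ?ltr0n ?fact_gt0//; last first.
    exact: num_coprime_fact_gt0.
  rewrite lnXn// lnM ?posrE// ?ltr0n ?fact_gt0// -[leLHS]mulr_natl.
  have := ln_fact_le R m; nra.
apply: le_trans h1 _.
have h2 := @sum_omega_le R N y; rewrite y0 y1 in h2.
(* The factor 10 is 5 from [sum_omega_le] times 2 from [ln x <= 2 ln N]; 11 is 10 from the primes
   plus 1 from the higher prime powers. *)
have {}h2 : \sum_(1 <= n < N.+1) y ^+ omega n <= 10 * (x / ln x) * expR (y * (ln (ln x) + 11)).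
  have lx0 : 0 < ln x by lra.
  rewrite -(ler_pM2r lN0); apply: le_trans (h2 isT) _.
  have h3 : expR (y * sum_inv_prime_powers R N) <= expR (y * (ln (ln x) + 11)).
    rewrite ler_expR ler_wpM2l//.
    have := sum_inv_prime_powers_le R N; have := sum_inv_primes_le R N2.
    have : ln (ln N%:R) <= ln (ln x) by rewrite ler_ln.
    lra.
  rewrite [leRHS]mulrAC.
  apply: ler_pM; [by rewrite mulr_ge0|exact: expR_ge0| |exact: h3].
  have -> : 10 * (x / ln x) * ln N%:R = 5 * x * (2 * ln N%:R / ln x) by field; lra.
  have : 1 <= 2 * ln N%:R / ln x by rewrite ler_pdivlMr// mul1r.
  move: (2 * ln N%:R / ln x) => w w1.
  have : 0 <= x by lra.
  nra.
apply: le_trans (ler_wpM2l (expR_ge0 _) h2) _.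
rewrite addrAC expRD [9 + _]addrC expRD.
have e9 : 10 <= expR 9 :> R by have := @expR_ge1Dx R 9; lra.
have xl : 0 <= x / ln x by rewrite divr_ge0//; lra.
set A := expR (b * _); set B := expR (y * _); set X := x / ln x in xl *.
have A0 : 0 <= A by exact: expR_ge0.
have B0 : 0 <= B by exact: expR_ge0.
have -> : A * (10 * X * B) = 10 * (X * (A * B)) by ring.
have -> : X * (B * expR 9 * A) = expR 9 * (X * (A * B)) by ring.
by apply: ler_wpM2r => //; exact: mulr_ge0 xl (mulr_ge0 A0 B0).
Qed.

(** The count of squarefree [n] with [K.+1] primes is multiplied by the [-b]-th power of the Bell
    bound, where [T] stays a free parameter. The last three hypotheses make [x] large in terms of
    [K]. *)
Lemma neg_moment_num_fact_ge (R : realType) (b x T : R) (K : nat) :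
  0 <= b -> 4 <= x -> (0 < K)%N -> 1 <= T -> K.+1%:R <= T * ln T ->
  10 * K%:R <= ln (ln x) -> 4 * ln (ln x) <= ln x ->
  48 * (ln x * ln x) <= expR (ln x / 2) ->
  x / ln x * expR (- 48 - ln K.+1%:R + K%:R * ln (ln (ln x) - 5 * K%:R) - ln K`!%:R
    - b * (ln K.+2%:R + K.+1%:R * ln T - K.+1%:R + T)) <=
  neg_moment num_fact b x.
Proof.
move=> b0 x4 K0 T1 KT KL Ly yW.
have x0 : 0 < x by lra.
have K1 : 1 <= K%:R :> R by rewrite ler1n.
have [N2 Nx xN lNx lxN] := truncn_bounds x4.
rewrite /neg_moment; set N := Num.truncn x in N2 Nx xN lNx lxN *.
set y := ln x in KL Ly yW lNx lxN *; set L := ln y in KL Ly *.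
have y40 : 40 * K%:R <= y by lra.
have y0 : 0 < y by lra.
have N0 : 0 < N%:R :> R by rewrite ltr0n ltnW.
have lN0 : 0 < ln N%:R :> R by rewrite ln_gt0// ltr1n.
have xW : x = expR (y / 2) * expR (y / 2) by rewrite -expRD -splitr lnK ?posrE.
set W := expR (y / 2) in yW xW.
(* With [z] the integer part of [expR q = x ^ (1 / (2 K))], [z ^ K] is at most [W], the square root
   of [x], which leaves room for the last prime. *)
pose q := y / (2 * K%:R).
have Kq : K%:R * q = y / 2 by rewrite /q; field; lra.
have q20 : 20 <= q by rewrite /q ler_pdivlMr; lra.
have Y4 : 4 <= expR q by have := expR_ge1Dx q; lra.
have [z2 zY _ _ lYz] := truncn_bounds Y4.
set z := Num.truncn (expR q) in z2 zY lYz; rewrite expRK in lYz.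
have zK : (z ^ K)%:R <= W :> R.
  by rewrite natrX /W -Kq expRM_natl; apply: lerXn2r; rewrite ?nnegrE ?expR_ge0.
have W48 : 48 * y * K%:R <= W.
  apply: le_trans yW; rewrite -mulrA ler_wpM2l// ler_wpM2l//; lra.
have W1 : 48 <= W by apply: le_trans W48; nra.
have zN : (z ^ K * 2 <= N)%N by rewrite -(ler_nat R) natrM; nra.
have hK : 24 * K%:R * ln N%:R * (z ^ K)%:R <= N%:R :> R.
  apply: (@le_trans _ _ (24 * K%:R * y * W)).
    by apply: ler_pM => //; rewrite ?mulr_ge0 ?(ltW lN0)// ler_wpM2l ?mulr_ge0.
  nra.
have z0 : (0 < z)%N by exact: ltnW.
have hC := squarefree_count_ge z0 zN hK.
have lz0 : 0 < ln z%:R :> R by rewrite ln_gt0// ltr1n.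
have lq : L - ln (4 * K%:R) <= ln (ln z%:R).
  rewrite /L -ln_div ?posrE//; last lra.
  rewrite ler_ln ?posrE ?divr_gt0//; last lra.
  have -> : y / (4 * K%:R) = q / 2 by rewrite /q; clear -K1; field; lra.
  by rewrite ler_pdivrMr// mulrC.
have l4K : ln (4 * K%:R) <= 4 * K%:R - 1 :> R.
  by apply: ln_le_subr1; clear -K1; lra.
(* The loss [5 K] consists of [ln (4 K) <= 4 K - 1] from lowering [x] to [z], 1 from Mertens' lower
   bound, and the [K] of [elem_sum_ge]. *)
have PL : L - 5 * K%:R <= sum_inv_primes R z - K%:R.
  have := sum_inv_primes_ge R z2; clear -lq l4K; lra.
have LK : 0 < L - 5 * K%:R by clear -KL K1; lra.
have hP : K%:R <= sum_inv_primes R z by clear -PL LK; lra.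
have hE := elem_sum_ge z0 hP.
have fK : 0 < K`!%:R :> R by rewrite ltr0n fact_gt0.
have {}hE : expR (K%:R * ln (L - 5 * K%:R) - ln K`!%:R) <= elem_sum R z K.
  apply: le_trans hE; rewrite expRB lnK ?posrE// ler_pM2r ?invr_gt0//.
  rewrite expRM_natl lnK ?posrE//.
  by rewrite lerXn2r ?nnegrE//; clear -PL LK; lra.
have e48 : expR (- 48) <= 48^-1 :> R.
  by rewrite expRN lef_pV2 ?posrE ?expR_gt0//; have := @expR_ge1Dx R 48; clear; lra.
have hN : x / y * expR (- 48) <= N%:R / (24 * ln N%:R).
  apply: (@le_trans _ _ (x / y / 48)); first by rewrite ler_wpM2l// divr_ge0// ltW.
  have -> : x / y / 48 = (x / 2) / (24 * y) by clear -y0; field; lra.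
  apply: ler_pM.
  - by rewrite divr_ge0// ltW.
  - by rewrite invr_ge0 mulr_ge0// ltW.
  - by rewrite ler_pdivrMr// mulrC.
  - by rewrite lef_pV2 ?posrE ?mulr_gt0// ler_wpM2l.
have hC2 : x / y * expR (- 48 - ln K.+1%:R + K%:R * ln (L - 5 * K%:R) - ln K`!%:R) <=
    squarefree_count R N K.+1.
  have K1' : 0 < K.+1%:R :> R by rewrite ltr0n.
  rewrite -(ler_pM2l K1'); apply: le_trans hC.
  set D := K%:R * _ - _ in hE.
  have -> : - 48 - ln K.+1%:R + K%:R * ln (L - 5 * K%:R) - ln K`!%:R =
    D - ln K.+1%:R - 48 by rewrite /D; ring.
  rewrite expRD (expRB D) lnK ?posrE//.
  have -> : K.+1%:R * (x / y * (expR D / K.+1%:R * expR (- 48))) =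
      x / y * expR (- 48) * expR D by clear -y0 K1'; field; rewrite nat1r; lra.
  apply: ler_pM; [|exact: expR_ge0|exact: hN|exact: hE].
  by rewrite mulr_ge0 ?expR_ge0// divr_ge0// ltW.
set Bd := ln K.+2%:R + K.+1%:R * ln T - K.+1%:R + T.
rewrite expRD mulrA.
apply: (@le_trans _ _ (\sum_(1 <= n < N.+1 | squarefree_omega K.+1 n)
    (num_fact n)%:R `^ (- b))); last first.
  by rewrite big_mkcond; apply: ler_sum => n _; case: ifP => // _; exact: powR_ge0.
apply: (@le_trans _ _ (squarefree_count R N K.+1 * expR (- (b * Bd)))).
  by rewrite ler_wpM2r ?expR_ge0.
rewrite /squarefree_count mulr_suml big_nat_cond [leRHS]big_nat_cond.
apply: ler_sum => n /andP[/andP[n0 _] sq]; rewrite mul1r.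
have f0 : 0 < (num_fact n)%:R :> R.
  by rewrite ltr0n (leq_trans (num_coprime_fact_gt0 n0))// num_coprime_fact_le.
have fB : (num_fact n)%:R <= expR Bd.
  apply: le_trans (num_fact_squarefree_le R sq) _.
  apply: le_trans (bell_bound_le T1 KT) _.
  by rewrite /Bd -!addrA [leRHS]expRD lnK ?posrE ?ltr0n.
apply: le_trans (powRN_anti b0 f0 fB).
by rewrite /powR expR_eq0 expRK mulNr.
Qed.

(** The induction step reduces to [(K + 1) * (ln (K + 1) - ln K) >= 1]. *)
Lemma ln_fact_le_stirling (R : realType) (K : nat) : (0 < K)%N ->
  ln K`!%:R <= K%:R * ln K%:R - K%:R + ln K%:R + 1 :> R.
Proof.
elim: K => // K IH _; have [->|K0] := posnP K.
  by rewrite factS fact0 muln1 ln1; lra.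
have K0' : 0 < K%:R :> R by rewrite ltr0n.
have K1' : 0 < K.+1%:R :> R by rewrite ltr0n.
rewrite factS natrM lnM ?posrE ?ltr0n ?fact_gt0//.
have {IH} := IH K0; have := ln_ln_diff K0' (_ : K%:R <= K.+1%:R).
rewrite ler_nat leqnSn => /(_ isT).
have -> : K.+1%:R - K%:R = 1 :> R by rewrite -natr1; ring.
rewrite ler_pdivrMr// -natr1.
move: (ln (K%:R + 1)) (ln K%:R) (ln K`!%:R) => u v w; nra.
Qed.

(** * Asymptotics *)

(* With [L] the double logarithm of [x] and [l := ln L], the optimal block
   number is [mu := expR lam], where [mu ^ (1 + b) = (1 + b) L / l]; then the
   main exponent is [mu * l] and the optimal number of primes is
   [kappa := mu * l / (1 + b) = L / mu ^ b]. *)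
Definition log_blocks (R : realType) (b l : R) : R :=
  (ln (1 + b) + l - ln l) / (1 + b).

Lemma exponent_mainE (R : realType) (b x : R) : 0 < b -> 1 < ln (ln x) ->
  let l := ln (ln (ln x)) in
  exponent_main b x = expR (log_blocks b l) * l.
Proof.
move=> b0 L1 l; have l0 : 0 < l by rewrite ln_gt0.
have L0 : 0 < ln (ln x) by lra.
rewrite /exponent_main /log_iter /= -/l -[X in _ = _ * X]lnK ?posrE// -expRD.
have p0 : 0 < (1 + b) * ln (ln x) * l `^ b by rewrite !mulr_gt0 ?powR_gt0//; lra.
rewrite {1}/powR gt_eqF//; congr expR.
rewrite lnM ?posrE ?mulr_gt0 ?powR_gt0//; try lra.
rewrite ln_powR lnM ?posrE//; last lra.
by rewrite -/l /log_blocks; field; lra.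
Qed.

Lemma optimal_primesE (R : realType) (b L : R) : 0 < b -> 1 < L ->
  let l := ln L in
  L * expR (- b * log_blocks b l) = expR (log_blocks b l) * l / (1 + b).
Proof.
move=> b0 L1 l; have l0 : 0 < l by rewrite ln_gt0.
have b1 : 0 < 1 + b by lra.
have := congr1 (@expR R) (_ : l + - b * log_blocks b l = log_blocks b l + ln l - ln (1 + b)).
rewrite expRB !expRD !lnK ?posrE//; last lra.
by apply; rewrite /log_blocks; field; lra.
Qed.

(** With [kap = mu * l / (1 + b)], the main terms are [b * mu * lam <= b * kap] and
    [L * mu ^ (-b) = kap], which add up to [mu * l]. Rounding and constants cost at most
    [2 * l <= d * mu * l]. *)
Lemma upper_exponent_le (R : realType) (b d L : R) (l := ln L) (lam := log_blocks b l)
    (mu := expR lam) (m := (Num.truncn mu).+1) :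
  0 < b -> 0 < d -> 1 < L -> 0 <= lam -> lam <= l / (1 + b) ->
  20 + 2 * b <= l -> 2 / d <= mu ->
  9 + b * (m%:R * ln m%:R) + expR (- b * ln m%:R) * (L + 11) <= (1 + d) * (mu * l).
Proof.
move=> b0 d0 L1 lam0 laml lb dmu.
have b1 : 0 < 1 + b by lra.
have mu1 : 1 <= mu by rewrite /mu -[leLHS]expR0 ler_expR.
have mu0 : 0 < mu by lra.
have /andP[mu_ge mu_lt] := truncn_itv (ltW mu0).
rewrite -/m in mu_lt.
have m_le : m%:R <= mu + 1 by rewrite /m -natr1 lerD2r.
have m0 : 0 < m%:R :> R by rewrite ltr0n.
have lmu : ln mu = lam by rewrite /mu expRK.
have lmu1 : ln (mu + 1) <= lam + mu^-1.
  have -> : mu + 1 = mu * (1 + mu^-1) by rewrite mulrDr mulr1 mulfV// gt_eqF.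
  have i0 : 0 < mu^-1 by rewrite invr_gt0.
  rewrite lnM ?posrE//; last lra.
  by rewrite lmu lerD2l le_ln1Dx//; lra.
have i1 : mu^-1 <= 1 by rewrite invf_le1.
have mui : mu * mu^-1 = 1 by rewrite mulfV// gt_eqF.
have lm : ln m%:R <= lam + mu^-1.
  by apply: le_trans lmu1; rewrite ler_ln ?posrE//; lra.
have lm0 : lam <= ln m%:R by rewrite -lmu ler_ln ?posrE// ltW.
have h1 : m%:R * ln m%:R <= mu * lam + lam + 2.
  apply: (@le_trans _ _ ((mu + 1) * (lam + mu^-1))).
    by apply: ler_pM => //; exact: le_trans lm0.
  have -> : (mu + 1) * (lam + mu^-1) = mu * lam + lam + (mu * mu^-1 + mu^-1) by ring.
  rewrite mui; lra.
have h2 : expR (- b * ln m%:R) <= expR (- b * lam).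
  by rewrite ler_expR !mulNr lerN2 ler_wpM2l// ltW.
have h3 : expR (- b * lam) <= 1.
  by rewrite -[leRHS]expR0 ler_expR mulNr oppr_le0 mulr_ge0// ltW.
have h4 := optimal_primesE b0 L1; rewrite -/l -/lam -/mu /= in h4.
set kap := mu * l / (1 + b) in h4.
have kE : (1 + b) * kap = mu * l by rewrite /kap mulrC divfK ?gt_eqF.
have h5 : expR (- b * ln m%:R) * (L + 11) <= kap + 11.
  apply: (@le_trans _ _ (expR (- b * lam) * (L + 11))).
    by rewrite ler_wpM2r//; lra.
  rewrite mulrDr (mulrC _ L) h4; lra.
have l0 : 0 < l by lra.
have h6 : mu * lam <= kap by rewrite /kap -mulrA ler_wpM2l// ltW.
have h7 : (1 + b) * lam <= l by move: laml; rewrite ler_pdivlMr// mulrC.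
have h8 : 2 * l <= d * (mu * l).
  rewrite mulrA ler_wpM2r ?(ltW l0)//.
  by move: dmu; rewrite ler_pdivrMr// mulrC.
have h9 : b * (m%:R * ln m%:R) <= b * kap + l + 2 * b.
  apply: (@le_trans _ _ (b * (kap + lam + 2))); first by rewrite ler_wpM2l; lra.
  lra.
clear - h5 h8 h9 kE lb; lra.
Qed.

Lemma ln_1B_ge (R : realType) (t : R) : 0 <= t -> t <= 1 / 2 -> - (2 * t) <= ln (1 - t).
Proof.
move=> t0 t2; have u0 : 0 < 1 - t by lra.
have := @le_ln1Dx R (t / (1 - t)).
have -> : 1 + t / (1 - t) = (1 - t)^-1 by field; lra.
rewrite lnV ?posrE// => h.
have t3 : 0 <= t / (1 - t) by rewrite divr_ge0// ltW.
have t4 : t / (1 - t) <= 2 * t by rewrite ler_pdivrMr//; nra.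
have /h : -1 < t / (1 - t) by lra.
lra.
Qed.

(** Since [ln K <= l - b * lam], the count contributes about [K * (b * lam + 1)], and the Bell bound
    costs about [b * K * (lam - 1)]. The terms in [lam] cancel, leaving [(1 + b) * K], close to
    [mu * l]. *)
Lemma lower_exponent_ge (R : realType) (b d e L : R) (l := ln L) (lam := log_blocks b l)
    (mu := expR lam) (K := Num.truncn (mu * l / (1 + b))) (T := (1 + e) * mu) :
  0 < b -> 0 < d -> 1 < L -> 0 < e -> e <= 1 -> 8 * b * e <= d ->
  1 + b <= mu -> 8 * b <= d * l -> 51 + 2 * b <= l -> 4 * (4 + b) <= d * mu ->
  40 * expR (- b * lam) <= d -> 10 * expR (- b * lam) <= 1 ->
  4 * ln l <= e * l -> 2 * (1 + b) <= e * l -> 0 <= lam ->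
  [/\ (0 < K)%N, 1 <= T, K.+1%:R <= T * ln T, 10 * K%:R <= L &
    (1 - d) * (mu * l) <=
    - 48 - ln K.+1%:R + K%:R * ln (L - 5 * K%:R) - ln K`!%:R
    - b * (ln K.+2%:R + K.+1%:R * ln T - K.+1%:R + T)].
Proof.
move=> b0 d0 L1 e0 e1 be bmu bl lb dmu de ee le2 be2 lam0.
have b1 : 0 < 1 + b by lra.
have L0 : 0 < L by lra.
have mu1 : 1 <= mu by lra.
have mu0 : 0 < mu by lra.
have l0 : 0 < l by lra.
have kapE := optimal_primesE b0 L1; rewrite -/l -/lam -/mu /= in kapE.
set kap := mu * l / (1 + b) in kapE K *.
set ep := expR (- b * lam) in de ee kapE.
have ep0 : 0 < ep by exact: expR_gt0.
have kE : (1 + b) * kap = mu * l by rewrite /kap mulrC divfK ?gt_eqF.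
have kap1 : 1 <= kap by rewrite /kap ler_pdivlMr// mul1r; nra.
have kap0 : 0 < kap by lra.
have /andP[Kk kK] := truncn_itv (ltW kap0); rewrite -/K in Kk kK.
have K0 : (0 < K)%N by rewrite truncn_gt0.
have K1 : 1 <= K%:R :> R by rewrite ler1n.
have KS : K.+1%:R = K%:R + 1 :> R by rewrite -natr1.
have KSS : K.+2%:R = K%:R + 2 :> R by rewrite -natr1 KS; ring.
rewrite KS in kK.
have lmu : ln mu = lam by rewrite /mu expRK.
have T1 : 1 <= T by apply: (le_trans mu1); rewrite /T ler_peMl ?(ltW mu0)// lerDl ltW.
have lT : ln T = ln (1 + e) + lam by rewrite /T lnM ?posrE ?lmu//; lra.
have le0 : 0 <= ln (1 + e) by rewrite ln_ge0//; lra.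
have lee : ln (1 + e) <= e by rewrite le_ln1Dx//; lra.
have lamE : (1 + b) * lam = ln (1 + b) + l - ln l.
  by rewrite /lam /log_blocks mulrC divfK// gt_eqF.
have lb0 : 0 <= ln (1 + b) by rewrite ln_ge0//; lra.
have lkap : ln kap = l - b * lam.
  rewrite -kapE lnM ?posrE// expRK -/l; ring.
have lkap0 : 0 <= ln kap by rewrite ln_ge0.
have blam : b * lam <= l by lra.
have blam0 : 0 <= b * lam by rewrite mulr_ge0// ltW.
(* At [mu] itself [mu * lam] may fall short of [kap] because of the [ln l] in [lam]; the factor
   [1 + e] in [T] makes up for it. *)
have hT : kap + 1 <= T * ln T.
  rewrite -(ler_pM2l b1) mulrDr kE mulr1.
  apply: (@le_trans _ _ (mu * ((1 + e) * ((1 + b) * lam)))).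
    rewrite lamE; apply: (@le_trans _ _ (mu * (l + (1 + b)))).
      by rewrite mulrDr lerD2l; nra.
    rewrite ler_wpM2l ?(ltW mu0)//.
    have : 0 <= ln l by rewrite ln_ge0//; lra.
    clear - e0 e1 le2 be2 lb0; nra.
  have -> : mu * ((1 + e) * ((1 + b) * lam)) = (1 + b) * (T * lam) by rewrite /T; ring.
  by rewrite ler_wpM2l ?(ltW b1)// ler_wpM2l ?(le_trans ler01 T1)// lT lerDr.
have KL : 10 * K%:R <= L.
  apply: (@le_trans _ _ (10 * (L * ep))); first by rewrite ler_wpM2l// kapE.
  by rewrite mulrCA -[leRHS]mulr1 ler_wpM2l// ltW.
split=> //; first by rewrite KS; apply: le_trans hT; rewrite lerD2r.
have h6 : T <= 2 * mu by rewrite /T ler_wpM2r ?(ltW mu0)//; clear -e1; lra.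
clear hT T1 bmu le2 be2 lamE lb0.
clearbody T K kap ep mu lam.
have h1 : ln K.+1%:R <= l + 1.
  apply: (@le_trans _ _ (ln (2 * kap))); first by rewrite KS ler_ln ?posrE; clear -kap1 Kk K1; lra.
  rewrite lnM ?posrE// lkap; have /andP[_] := ln2_bounds R; clear -blam0; lra.
have h2 : ln K.+2%:R <= l + 2.
  apply: (@le_trans _ _ (ln (3 * kap))); first by rewrite KSS ler_ln ?posrE; clear -kap1 Kk K1; lra.
  rewrite lnM ?posrE// lkap.
  have : ln 3 <= 3 - 1 :> R by exact: ln_le_subr1.
  clear -blam0; lra.
(* The ratio [K / L] is at most [kap / L = ep], which is small, and [ln (1 - t) >= -2 t]. *)
have h3 : K%:R * l - 10 * ep * kap <= K%:R * ln (L - 5 * K%:R).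
  set t := 5 * K%:R / L.
  have t0 : 0 <= t by rewrite /t divr_ge0// ltW.
  have t2 : t <= 5 * ep.
    by rewrite /t ler_pdivrMr// -mulrA ler_wpM2l// mulrC kapE.
  have t3 : t <= 1 / 2 by rewrite /t ler_pdivrMr//; clear -KL; lra.
  have -> : L - 5 * K%:R = L * (1 - t).
    by rewrite mulrBr mulr1 /t mulrCA mulfV ?gt_eqF// mulr1.
  rewrite lnM ?posrE//; last by clear -t3; lra.
  have := ln_1B_ge t0 t3; rewrite -/l => t4.
  rewrite mulrDr lerD2l.
  apply: (@le_trans _ _ (K%:R * (- (2 * t)))); last by rewrite ler_wpM2l.
  rewrite mulrN lerN2.
  have := ler_pM (ler0n R K) t0 Kk t2; clear; lra.
have h4 : ln K`!%:R <= K%:R * (l - b * lam) - K%:R + l + 1.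
  apply: le_trans (ln_fact_le_stirling R K0) _.
  have lKk : ln K%:R <= ln kap by rewrite ler_ln ?posrE//; clear -K1; lra.
  rewrite -lkap !lerD2r; apply: lerD; last lra.
  by rewrite lerD2r ler_wpM2l.
have h5 : K.+1%:R * ln T <= (K%:R + 1) * lam + 2 * e * kap.
  rewrite KS lT mulrDr addrC lerD2l.
  apply: (@le_trans _ _ ((K%:R + 1) * e)); first by rewrite ler_wpM2l//; clear -K1; lra.
  clear -e0 Kk kap1; nra.
have kapE2 : kap <= mu * l by rewrite -kE mulrDl mul1r lerDl mulr_ge0 ?(ltW b0) ?(ltW kap0).
(* The error allowance [d] is split into [d / 2], [d / 4] and [d / 4], for terms of size [kap], [l]
   and [mu]. *)
have g1 : 10 * ep * kap + b * (2 * e * kap) <= d / 2 * (mu * l).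
  apply: (@le_trans _ _ (d / 2 * kap)); last by rewrite ler_wpM2l// divr_ge0// ltW.
  have -> : 10 * ep * kap + b * (2 * e * kap) = (10 * ep + 2 * b * e) * kap by ring.
  rewrite ler_wpM2r ?(ltW kap0)//; clear -de be; lra.
have g2 : (4 + b) * l <= d / 4 * (mu * l).
  rewrite mulrA ler_wpM2r ?(ltW l0)//; clear -dmu; lra.
have g3 : 2 * b * mu <= d / 4 * (mu * l).
  rewrite (mulrC mu) mulrA ler_wpM2r ?(ltW mu0)//; clear -bl; lra.
have p1 : b * ln K.+2%:R <= b * (l + 2) by rewrite ler_wpM2l// ltW.
have p2 : b * (K.+1%:R * ln T) <= b * ((K%:R + 1) * lam + 2 * e * kap).
  by rewrite ler_wpM2l// ltW.
have p3 : b * T <= b * (2 * mu) by rewrite ler_wpM2l// ltW.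
have p4 : (1 + b) * kap <= (1 + b) * (K%:R + 1) by rewrite ler_wpM2l// ltW.
rewrite kE in p4; rewrite KS in p1 p2 h1 *.
clear - h1 h3 h4 g1 g2 g3 p1 p2 p3 p4 blam lb; lra.
Qed.

(** * Thresholds for large [x] and conclusion *)

Lemma ln_le_cmul (R : realType) (c y : R) : 0 < c -> 4 / (c * c) <= y -> ln y <= c * y.
Proof.
move=> c0 cy; have y0 : 0 < y by apply: lt_le_trans cy; rewrite divr_gt0 ?mulr_gt0.
pose u := ln y / 2; have yu : y = expR u * expR u by rewrite -expRD -splitr lnK ?posrE.
have -> : ln y = 2 * u by rewrite /u mulrC divfK.
have eu := expR_ge1Dx u; have e0 := expR_gt0 u.
have [u0|u0] := leP u 0; first by apply: (@le_trans _ _ 0); [lra|rewrite mulr_ge0 ?ltW].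
have h : 2 <= c * expR u.
  move: cy; rewrite yu ler_pdivrMr ?mulr_gt0// => h.
  rewrite leNgt; apply/negP => h2.
  have : (c * expR u) * (c * expR u) < 2 * 2.
    by apply: ltr_pM => //; rewrite mulr_ge0 ?ltW.
  have -> : (c * expR u) * (c * expR u) = expR u * expR u * (c * c) by ring.
  lra.
rewrite yu mulrA; apply: (@le_trans _ _ (2 * expR u)); first by rewrite ler_wpM2l//; lra.
by rewrite ler_wpM2r ?(ltW e0).
Qed.

Lemma log_blocks_ge (R : realType) (b B l : R) : 0 < b -> 16 <= l ->
  2 * (1 + b) * B <= l -> B <= log_blocks b l.
Proof.
move=> b0 l16 Bl; rewrite /log_blocks ler_pdivlMr; last lra.
have lb0 : 0 <= ln (1 + b) by rewrite ln_ge0//; lra.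
have : ln l <= 1 / 2 * l by apply: ln_le_cmul => //; lra.
lra.
Qed.

Lemma near_lnlnln (R : realType) (A : R) : \forall x \near +oo, A <= ln (ln (ln x)).
Proof.
near=> x; have hx : expR (expR (expR A)) <= x.
  by near: x; apply: nbhs_pinfty_ge; exact: num_real.
have x0 : 0 < x := lt_le_trans (expR_gt0 _) hx.
have h1 : expR (expR A) <= ln x by rewrite -ler_expR lnK.
have h2 : expR A <= ln (ln x).
  by rewrite -ler_expR lnK// posrE (lt_le_trans _ h1)// expR_gt0.
by rewrite -ler_expR lnK// posrE (lt_le_trans _ h2)// expR_gt0.
Unshelve. all: by end_near. Qed.

Lemma lnlnln_large (R : realType) (x : R) : 256 <= ln (ln (ln x)) ->
  [/\ 4 <= x, 1 < ln (ln x), 4 * ln (ln x) <= ln x &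
     48 * (ln x * ln x) <= expR (ln x / 2)].
Proof.
move=> h; have ln_gt (y : R) : 256 <= ln y -> 256 < y.
  (* As [ln] is 0 at nonpositive arguments, a large logarithm forces a positive argument. *)
  move=> hy; have [y0|y0] := leP y 0; first by move: hy; rewrite ln0//; lra.
  by apply: le_lt_trans hy _; exact: ln_sublinear.
have L256 := ln_gt _ h; have y256 := ln_gt _ (ltW L256); have x256 := ln_gt _ (ltW y256).
split; [lra|lra| |].
  have : ln (ln x) <= 1 / 4 * ln x by apply: ln_le_cmul; lra.
  lra.
set y := ln x in y256 *.
have y0 : 0 < y by lra.
rewrite -[48]lnK ?posrE// -[y in _ * (y * _)]lnK ?posrE// -[y in _ * (_ * y)]lnK ?posrE//.
rewrite -!expRD ler_expR.
(* The threshold 256 is [4 / (1/8)^2], as [ln_le_cmul] requires for the slope [1/8]. *)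
have h1 : ln y <= 1 / 8 * y by apply: ln_le_cmul; lra.
have h2 : ln 48 < 48 :> R by exact: ln_sublinear.
lra.
Qed.

Lemma near_num_coprime_fact_le (R : realType) (b d : R) : 0 < b -> 0 < d ->
  \forall x \near +oo, neg_moment num_coprime_fact b x <=
    x / ln x * expR ((1 + d) * exponent_main b x).
Proof.
move=> b0 d0; near=> x.
have b1 : 0 < 1 + b by lra.
have l0 : 256 <= ln (ln (ln x)) by near: x; exact: near_lnlnln.
have [x4 L1 _ _] := lnlnln_large l0.
have l1 : 20 + 2 * b <= ln (ln (ln x)) by near: x; exact: near_lnlnln.
have l2 : 2 * (1 + b) * (2 / d) <= ln (ln (ln x)) by near: x; exact: near_lnlnln.
rewrite exponent_mainE//; set l := ln (ln (ln x)) in l0 l1 l2 *.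
have l16 : 16 <= l by lra.
have lam2 := log_blocks_ge b0 l16 l2.
have lam0 : 0 <= log_blocks b l by apply: le_trans lam2; rewrite divr_ge0// ltW.
apply: le_trans (neg_moment_num_coprime_fact_le (m := (Num.truncn (expR (log_blocks b l))).+1) b0 x4 _) _ => //.
rewrite ler_wpM2l//; first by rewrite divr_ge0 ?ln_ge0//; lra.
rewrite ler_expR; apply: upper_exponent_le => //.
  rewrite -/l /log_blocks ler_pM2r ?invr_gt0//.
  have : ln (1 + b) <= ln l by rewrite ler_ln ?posrE; lra.
  lra.
by apply: le_trans lam2 _; have := expR_ge1Dx (log_blocks b l); lra.
Unshelve. all: by end_near. Qed.

Lemma near_num_fact_ge (R : realType) (b d : R) : 0 < b -> 0 < d ->
  \forall x \near +oo, x / ln x * expR ((1 - d) * exponent_main b x) <=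
    neg_moment num_fact b x.
Proof.
move=> b0 d0; near=> x.
have b1 : 0 < 1 + b by lra.
(* This choice ensures both [e <= 1] and [8 * b * e <= d]. *)
pose e := d / (8 * b + d).
have bd0 : 0 < 8 * b + d by lra.
have e0 : 0 < e by rewrite divr_gt0.
have e1 : e <= 1 by rewrite ler_pdivrMr//; lra.
have be : 8 * b * e <= d.
  by rewrite /e mulrA ler_pdivrMr// mulrC ler_wpM2l//; lra.
have l0 : 256 <= ln (ln (ln x)) by near: x; exact: near_lnlnln.
have [x4 L1 Ly yW] := lnlnln_large l0.
have l1 : 8 * b / d <= ln (ln (ln x)) by near: x; exact: near_lnlnln.
have l2 : 51 + 2 * b <= ln (ln (ln x)) by near: x; exact: near_lnlnln.
have l3 : 2 * (1 + b) / e <= ln (ln (ln x)) by near: x; exact: near_lnlnln.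
have l4 : 4 / (e / 4 * (e / 4)) <= ln (ln (ln x)) by near: x; exact: near_lnlnln.
have l5 : 2 * (1 + b) * (4 * (4 + b) / d) <= ln (ln (ln x)) by near: x; exact: near_lnlnln.
have l6 : 2 * (1 + b) * ((40 / d + 10) / b) <= ln (ln (ln x)) by near: x; exact: near_lnlnln.
have l7 : 2 * (1 + b) * (1 + b) <= ln (ln (ln x)) by near: x; exact: near_lnlnln.
rewrite exponent_mainE//.
set l := ln (ln (ln x)) in l0 l1 l2 l3 l4 l5 l6 l7 *.
have l16 : 16 <= l by clear -l0; lra.
have lam1 := log_blocks_ge b0 l16 l5.
have lam2 := log_blocks_ge b0 l16 l6.
have lam3 := log_blocks_ge b0 l16 l7.
have lam0 : 0 <= log_blocks b l by clear -b1 lam3; lra.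
have mul := expR_ge1Dx (log_blocks b l).
(* One bound serves both smallness conditions on [mu ^ (-b)]: the summand [40 / d] gives the first,
   10 the second. *)
have ep : expR (- b * log_blocks b l) <= (40 / d + 10)^-1.
  have q0 : 0 < 40 / d + 10 by rewrite addr_gt0 ?divr_gt0.
  rewrite mulNr expRN lef_pV2 ?posrE ?expR_gt0//.
  move: lam2; rewrite ler_pdivrMr// mulrC => lam2.
  have := expR_ge1Dx (b * log_blocks b l); clear -lam2; lra.
have ep1 : 40 * (40 / d + 10)^-1 <= d.
  rewrite ler_pdivrMr ?addr_gt0 ?divr_gt0// mulrDr mulrCA mulfV ?gt_eqF//.
  clear -d0; lra.
have ep2 : 10 * (40 / d + 10)^-1 <= 1.
  by rewrite ler_pdivrMr ?addr_gt0 ?divr_gt0// mul1r lerDr divr_ge0// ltW.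
have h1 : 8 * b <= d * l by move: l1; rewrite ler_pdivrMr// [leRHS]mulrC.
have h2 : 2 * (1 + b) <= e * l by move: l3; rewrite ler_pdivrMr// [leRHS]mulrC.
have h3 : 4 * ln l <= e * l.
  have : ln l <= e / 4 * l by apply: ln_le_cmul; rewrite ?divr_gt0.
  clear; lra.
have h4 : 4 * (4 + b) <= d * expR (log_blocks b l).
  move: lam1; rewrite ler_pdivrMr// [leRHS]mulrC => lam1.
  by apply: le_trans lam1 _; rewrite ler_wpM2l ?(ltW d0)//; clear -mul; lra.
have h5 : 1 + b <= expR (log_blocks b l) by clear -mul lam3; lra.
have h6 : 40 * expR (- b * log_blocks b l) <= d by clear -ep ep1; lra.
have h7 : 10 * expR (- b * log_blocks b l) <= 1 by clear -ep ep2; lra.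
have [K0 T1 KT KL hle] :=
  lower_exponent_ge b0 d0 L1 e0 e1 be h5 h1 l2 h4 h6 h7 h3 h2 lam0.
apply: le_trans (neg_moment_num_fact_ge (ltW b0) x4 K0 T1 KT KL Ly yW).
rewrite ler_wpM2l ?ler_expR//.
by rewrite divr_ge0 ?ln_ge0//; clear -x4; lra.
Unshelve. all: by end_near. Qed.

Lemma moment_asymptotics_of_bounds (R : realType) (g : nat -> nat) (b : R) : 0 < b ->
  (forall d, 0 < d -> \forall x \near +oo,
    x / ln x * expR ((1 - d) * exponent_main b x) <= neg_moment g b x <=
    x / ln x * expR ((1 + d) * exponent_main b x)) ->
  moment_asymptotics g b.
Proof.
move=> b0 h.
(* The required equation is solved for [eps x]; the two-sided bounds then say that [eps x] lies
   eventually in [[-d, d]]. *)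
exists (fun x => ln (neg_moment g b x / (x / ln x)) / exponent_main b x - 1).
have pos : \forall x \near +oo, 0 < x / ln x /\ 0 < exponent_main b x.
  near=> x; have l0 : 256 <= ln (ln (ln x)) by near: x; exact: near_lnlnln.
  have [x4 L1 Ly _] := lnlnln_large l0.
  rewrite exponent_mainE// divr_gt0 ?mulr_gt0 ?expR_gt0//; lra.
split.
  apply/cvgrPdist_le => d d0; near=> x.
  have [X0 E0] : 0 < x / ln x /\ 0 < exponent_main b x by near: x.
  have /andP[h1 h2] : x / ln x * expR ((1 - d) * exponent_main b x) <= neg_moment g b x <=
    x / ln x * expR ((1 + d) * exponent_main b x) by near: x; exact: h.
  set S := neg_moment g b x in h1 h2 *; set X := x / ln x in X0 h1 h2 *.
  set E := exponent_main b x in E0 h1 h2 *.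
  have S0 : 0 < S by apply: lt_le_trans h1; rewrite mulr_gt0// expR_gt0.
  have SX0 : 0 < S / X by rewrite divr_gt0.
  have g1 : (1 - d) * E <= ln (S / X).
    by rewrite -ler_expR lnK// ler_pdivlMr// mulrC.
  have g2 : ln (S / X) <= (1 + d) * E.
    by rewrite -ler_expR lnK// ler_pdivrMr// mulrC.
  rewrite sub0r normrN ler_norml; apply/andP; split.
    by rewrite lerBrDr ler_pdivlMr// addrC.
  by rewrite lerBlDr ler_pdivrMr// addrC.
near=> x.
have [X0 E0] : 0 < x / ln x /\ 0 < exponent_main b x by near: x.
(* The case [d = 1] is used for the positivity of the moment, so that [expR] undoes [ln]. *)
have /andP[h1 _] : x / ln x * expR ((1 - 1) * exponent_main b x) <= neg_moment g b x <=
    x / ln x * expR ((1 + 1) * exponent_main b x) by near: x; exact: h.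
have S0 : 0 < neg_moment g b x by apply: lt_le_trans h1; rewrite mulr_gt0// expR_gt0.
rewrite subrKC divfK ?gt_eqF// lnK ?posrE ?(divr_gt0 S0 X0)//.
by rewrite mulrC divfK ?gt_eqF.
Unshelve. all: by end_near. Qed.

Theorem theorem1p9 (R : realType) (beta : R) (hbeta : 0 < beta) :
  moment_asymptotics num_fact beta /\ moment_asymptotics num_coprime_fact beta.
Proof.
(* As [F n <= f n], the sum for [f] is the smaller one: its lower bound and the upper bound for [F]
   carry over to both. *)
split; apply: moment_asymptotics_of_bounds => // d d0.
  near=> x; apply/andP; split; first by near: x; exact: near_num_fact_ge.
  apply: le_trans (neg_moment_num_fact_le _ (ltW hbeta)) _.
  by near: x; exact: near_num_coprime_fact_le.
near=> x; apply/andP; split; last by near: x; exact: near_num_coprime_fact_le.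
apply: le_trans (neg_moment_num_fact_le _ (ltW hbeta)).
by near: x; exact: near_num_fact_ge.
Unshelve. all: by end_near. Qed.
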